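(* There exist an index $k_0\in\mathbb{N}$ and constants $\bar\tau_0>0$, $C>0$, $C'>0$, with $\bar\tau_0,C,C'$ depending only on $d,s,\gamma,\tau_0,\kappa,\kappa_\nabla,\kappa_{\mathrm{hess}},\rho,R,L$, such that for every $\tau\in(0,\bar\tau_0]$, setting $k_\tau=C\lceil\log(\bar\tau_0/\tau)\rceil$: $\mathrm{dist}(\xi,X_k)\le\tau$ for all $k\ge k_0+k_\tau$, and for all $k\ge k_0+k_\tau+1$, $$\|q_k-q^\star\|_2\le C'\tau,\qquad \inf(\mathcal{P}(\Omega_k))\le\inf(\mathcal{P})+C'\tau^2.$$ In other words, the iterates eventually converge at a linear rate.
   Context: Setting: $\Omega\subseteq\mathbb{R}^d$ nonempty open convex; $\mathcal{M}(\Omega)$ finite signed Radon measures with total variation norm $\|\cdot\|_{\mathcal{M}}$, $\mathcal{M}(\Omega')$ those supported in $\Omega'\subseteq\Omega$; $a_1,\dots,a_m\in\mathcal{C}_0(\Omega)\cap\mathcal{C}^2(\Omega)$ with uniformly bounded first and second derivatives; $(A\mu)_i=\int a_i\,d\mu$, $A^*q=\sum_iq_ia_i$. $f:\mathbb{R}^m\to\mathbb{R}$ convex, bounded below, differentiable with $L$-Lipschitz gradient; $f^*$ its conjugate. $J(\mu)=\|\mu\|_{\mathcal{M}}+f(A\mu)$; $(\mathcal{P}(\Omega'))$: $\inf_{\mu\in\mathcal{M}(\Omega')}J(\mu)$; $(\mathcal{D}(\Omega'))$: $\sup\{-f^*(q):|A^*q(x)|\le1\ \forall x\in\Omega'\}$;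 $(\mathcal{P}),(\mathcal{D})$ for $\Omega'=\Omega$. Standing: all these problems used have solutions and no duality gap. Exchange algorithm: given $\Omega_0\subseteq\Omega$, for $k\ge0$, $\mu_k$ solves $(\mathcal{P}(\Omega_k))$, $q_k$ is the solution of $(\mathcal{D}(\Omega_k))$, $X_k$ is the set of local maximizers $x\in\Omega$ of $|A^*q_k|$ with $|A^*q_k(x)|>1$, $\Omega_{k+1}=\Omega_k\cup X_k$. For $Y,Z\subseteq\mathbb{R}^d$: $\mathrm{dist}(Y,Z)=\sup_{z\in Z}\inf_{y\in Y}\|y-z\|_2$ (equal to $0$ if $Z=\emptyset$); for a point $x$, $\mathrm{dist}(x,\xi)=\min_i\|x-\xi_i\|_2$. Constants: $\kappa=\sup_{\|q\|_2\le1}\|A^*q\|_\infty$, $\kappa_\nabla=\sup_{\|q\|_2\le1}\sup_x\|\nabla(A^*q)(x)\|_2$, $\kappa_{\mathrm{hess}}=\sup_{\|q\|_2\le1}\sup_x\|\nabla^2(A^*q)(x)\|_{\mathrm{op}}$; $\bar q$ the minimizer of $f^*$, $R=\sqrt{2L(f^*(0)-f^*(\bar q))}+\|\bar q\|_2$; $\rho=\sqrt{\sup_{w\in\partial f^*(q^\star)}-L\langle w,q^\star\rangle}$, assumed finite. Source condition: $(\mathcal{P})$ has a unique solution $\mu^\star=\sum_{i=1}^s\alpha_i^\star\delta_{\xi_i}$ (distinct $\xi_i\in\Omega$, $\alpha_i^\star\ne0$), $\xi=\{\xi_1,\dots,\xi_s\}$; $q^\star$ is the solution of $(\mathcal{D})$;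 $|A^*q^\star(x)|=1$ iff $x\in\xi$; and there are $\tau_0>0,\gamma>0$ with: for $x\in\Omega$ with $\mathrm{dist}(x,\xi)\le\tau_0$, $|A^*q^\star(x)|\ge\gamma\tau_0^2/2$ and $\nabla^2|A^*q^\star|(x)\preccurlyeq-\gamma\,\mathrm{Id}$; for $x\in\Omega$ with $\mathrm{dist}(x,\xi)\ge\tau_0$, $|A^*q^\star(x)|\le1-\gamma\tau_0^2/2$. *)

(* Defs.v *)
From HB Require Import structures.
From mathcomp Require Import all_boot all_order all_algebra.
From mathcomp Require Import all_classical all_reals all_analysis.
Set Implicit Arguments.
Unset Strict Implicit.
Unset Printing Implicit Defensive.
Import Order.TTheory GRing.Theory Num.Theory.
Import numFieldNormedType.Exports.
Local Open Scope classical_set_scope.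
Local Open Scope ring_scope.

Definition dotv (R : realType) (n : nat) (u v : 'rV[R]_n) : R :=
  \sum_(i < n) u 0 i * v 0 i.

Definition norm2 (R : realType) (n : nat) (v : 'rV[R]_n) : R :=
  Num.sqrt (\sum_(i < n) v 0 i ^+ 2).

Definition evec (R : realType) (n : nat) (i : 'I_n) : 'rV[R]_n := delta_mx 0 i.

Definition pderiv (R : realType) (n : nat) (i : 'I_n) (g : 'rV[R]_n -> R)
  (x : 'rV[R]_n) : R := 'D_(evec R i) g x.

Definition grad (R : realType) (n : nat) (g : 'rV[R]_n -> R) (x : 'rV[R]_n)
  : 'rV[R]_n := \row_i pderiv i g x.

Definition hess (R : realType) (n : nat) (g : 'rV[R]_n -> R) (x : 'rV[R]_n)
  : 'M[R]_n := \matrix_(i, j) pderiv i (pderiv j g) x.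

Definition opnorm2 (R : realType) (n : nat) (M : 'M[R]_n) : R :=
  sup [set r : R | exists u v : 'rV[R]_n,
        [/\ norm2 u <= 1, norm2 v <= 1 & r = (u *m M *m v^T) 0 0]].

Definition loewner_le_neg (R : realType) (n : nat) (H : 'M[R]_n) (gamma : R)
  : Prop := forall v : 'rV[R]_n, (v *m H *m v^T) 0 0 <= - gamma * norm2 v ^+ 2.

Definition C0_on (R : realType) (n : nat) (Om : set 'rV[R]_n)
  (g : 'rV[R]_n -> R) : Prop :=
  (forall x, Om x -> {for x, continuous g}) /\
  (forall e : R, 0 < e -> exists K : set 'rV[R]_n,
     [/\ compact K, K `<=` Om & forall x, Om x -> ~ K x -> `|g x| < e]).

Definition C2_on (R : realType) (n : nat) (Om : set 'rV[R]_n)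
  (g : 'rV[R]_n -> R) : Prop :=
  [/\ forall x, Om x -> differentiable g x,
      forall (v : 'rV[R]_n) x, Om x -> differentiable ('D_v g) x
    & forall (u v : 'rV[R]_n) x, Om x -> {for x, continuous ('D_u ('D_v g))}].

Definition Astar (R : realType) (d m : nat) (a : 'I_m -> 'rV[R]_d -> R)
  (q : 'rV[R]_m) (x : 'rV[R]_d) : R := \sum_(i < m) q 0 i * a i x.

Definition borelV (R : realType) (d : nat) := g_sigma_algebraType (@open 'rV[R]_d).

(** finite signed (Radon) measures on R^d: the library's charges *)
Notation smeasure R d := ({charge set (borelV R d) -> \bar R}).

Lemma hahn_ex (R : realType) (d : nat) (nu : smeasure R d) :
  exists PN : set (borelV R d) * set (borelV R d), hahn_decomposition nu PN.1 PN.2.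
Proof. by have [P [N h]] := Hahn_decomposition nu; exists (P, N). Qed.

Definition hahn_spec (R : realType) (d : nat) (nu : smeasure R d) :=
  projT2 (cid (hahn_ex nu)).

(** Jordan decomposition and total variation |nu| (library notions, for a
    chosen Hahn decomposition; they do not depend on the choice). *)
Definition mpos (R : realType) (d : nat) (nu : smeasure R d) := jordan_pos (hahn_spec nu).
Definition mneg (R : realType) (d : nat) (nu : smeasure R d) := jordan_neg (hahn_spec nu).
Definition tvar (R : realType) (d : nat) (nu : smeasure R d) :=
  charge_variation (hahn_spec nu).

Definition tvnorm (R : realType) (d : nat) (nu : smeasure R d) : R :=
  fine (tvar nu setT).

Definition sint (R : realType) (d : nat) (Om : set 'rV[R]_d) (nu : smeasure R d)
  (g : 'rV[R]_d -> R) : R :=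
  fine (\int[mpos nu]_(x in (Om : set (borelV R d))) (g x)%:E)
  - fine (\int[mneg nu]_(x in (Om : set (borelV R d))) (g x)%:E).

Definition ball2 (R : realType) (n : nat) (x : 'rV[R]_n) (e : R) : set 'rV[R]_n :=
  [set y | norm2 (y - x) < e].

Definition supp (R : realType) (d : nat) (nu : smeasure R d) : set 'rV[R]_d :=
  [set x | forall e : R, 0 < e -> tvar nu (ball2 x e : set (borelV R d)) != 0%E].

(** nu in M(Om'), as a measure on Om (i.e. |nu| vanishes outside Om),
    with support (relative to Om) contained in Om'. *)
Definition inM (R : realType) (d : nat) (Om Om' : set 'rV[R]_d) (nu : smeasure R d)
  : Prop :=
  tvar nu (~` Om : set (borelV R d)) = 0%E /\
  (forall x, Om x -> supp nu x -> Om' x).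

Definition Aop (R : realType) (d m : nat) (Om : set 'rV[R]_d)
  (a : 'I_m -> 'rV[R]_d -> R) (nu : smeasure R d) : 'rV[R]_m :=
  \row_i sint Om nu (a i).

Definition Jobj (R : realType) (d m : nat) (Om : set 'rV[R]_d)
  (a : 'I_m -> 'rV[R]_d -> R) (f : 'rV[R]_m -> R) (nu : smeasure R d) : R :=
  tvnorm nu + f (Aop Om a nu).

Definition infP (R : realType) (d m : nat) (Om Om' : set 'rV[R]_d)
  (a : 'I_m -> 'rV[R]_d -> R) (f : 'rV[R]_m -> R) : R :=
  inf [set Jobj Om a f nu | nu in [set nu | inM Om Om' nu]].

Definition solvesP (R : realType) (d m : nat) (Om Om' : set 'rV[R]_d)
  (a : 'I_m -> 'rV[R]_d -> R) (f : 'rV[R]_m -> R) (nu : smeasure R d) : Prop :=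
  inM Om Om' nu /\ forall nu', inM Om Om' nu' -> Jobj Om a f nu <= Jobj Om a f nu'.

Definition fstar (R : realType) (m : nat) (f : 'rV[R]_m -> R) (q : 'rV[R]_m)
  : \bar R := ereal_sup [set (dotv q z - f z)%:E | z in [set: 'rV[R]_m]].

Definition dual_feasible (R : realType) (d m : nat) (Om' : set 'rV[R]_d)
  (a : 'I_m -> 'rV[R]_d -> R) (q : 'rV[R]_m) : Prop :=
  forall x, Om' x -> `|Astar a q x| <= 1.

Definition supD (R : realType) (d m : nat) (Om' : set 'rV[R]_d)
  (a : 'I_m -> 'rV[R]_d -> R) (f : 'rV[R]_m -> R) : \bar R :=
  ereal_sup [set (- fstar f q)%E | q in [set q | dual_feasible Om' a q]].

Definition solvesD (R : realType) (d m : nat) (Om' : set 'rV[R]_d)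
  (a : 'I_m -> 'rV[R]_d -> R) (f : 'rV[R]_m -> R) (q : 'rV[R]_m) : Prop :=
  dual_feasible Om' a q /\
  forall q', dual_feasible Om' a q' -> (- fstar f q' <= - fstar f q)%E.

Definition subdiff (R : realType) (m : nat) (F : 'rV[R]_m -> \bar R) (q0 : 'rV[R]_m)
  : set 'rV[R]_m :=
  [set w | forall q, (F q0 + (dotv w (q - q0))%:E <= F q)%E].

Definition local_max (R : realType) (d : nat) (Om : set 'rV[R]_d)
  (g : 'rV[R]_d -> R) (x : 'rV[R]_d) : Prop :=
  Om x /\ exists e : R, 0 < e /\
    forall y, Om y -> norm2 (y - x) < e -> g y <= g x.

Definition Xset (R : realType) (d m : nat) (Om : set 'rV[R]_d)
  (a : 'I_m -> 'rV[R]_d -> R) (q : 'rV[R]_m) : set 'rV[R]_d :=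
  [set x | local_max Om (fun y => `|Astar a q y|) x /\ 1 < `|Astar a q x|].

Definition exchange_run (R : realType) (d m : nat) (Om : set 'rV[R]_d)
  (a : 'I_m -> 'rV[R]_d -> R) (f : 'rV[R]_m -> R) (Om0 : set 'rV[R]_d)
  (Oms : nat -> set 'rV[R]_d) (mus : nat -> smeasure R d) (qs : nat -> 'rV[R]_m)
  : Prop :=
  Oms 0%N = Om0 /\
  forall k : nat,
    [/\ solvesP Om (Oms k) a f (mus k),
        solvesD (Oms k) a f (qs k)
      & Oms k.+1 = Oms k `|` Xset Om a (qs k)].

Definition dist_pt (R : realType) (d s : nat) (x : 'rV[R]_d) (xi : 'I_s -> 'rV[R]_d)
  : R := inf (range (fun i => norm2 (x - xi i))).

(** dist(xi, Z) = sup_{z in Z} dist(z, xi)  (= 0 if Z is empty) *)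
Definition dist_set (R : realType) (d s : nat) (xi : 'I_s -> 'rV[R]_d)
  (Z : set 'rV[R]_d) : \bar R :=
  maxe 0%E (ereal_sup [set (dist_pt z xi)%:E | z in Z]).

Definition supnorm (R : realType) (d : nat) (Om : set 'rV[R]_d) (g : 'rV[R]_d -> R) : R :=
  sup [set `|g x| | x in Om].

Definition kappa0 (R : realType) (d m : nat) (Om : set 'rV[R]_d)
  (a : 'I_m -> 'rV[R]_d -> R) : R :=
  sup [set supnorm Om (Astar a q) | q in [set q : 'rV[R]_m | norm2 q <= 1]].

Definition kappa_grad (R : realType) (d m : nat) (Om : set 'rV[R]_d)
  (a : 'I_m -> 'rV[R]_d -> R) : R :=
  sup [set r : R | exists (q : 'rV[R]_m) x,
        [/\ norm2 q <= 1, Om x & r = norm2 (grad (Astar a q) x)]].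

Definition kappa_hess (R : realType) (d m : nat) (Om : set 'rV[R]_d)
  (a : 'I_m -> 'rV[R]_d -> R) : R :=
  sup [set r : R | exists (q : 'rV[R]_m) x,
        [/\ norm2 q <= 1, Om x & r = opnorm2 (hess (Astar a q) x)]].

Definition Rconst (R : realType) (m : nat) (f : 'rV[R]_m -> R) (L : R) (qbar : 'rV[R]_m)
  : R := Num.sqrt (2 * L * (fine (fstar f 0) - fine (fstar f qbar))) + norm2 qbar.

Definition rho2 (R : realType) (m : nat) (f : 'rV[R]_m -> R) (L : R) (qstar : 'rV[R]_m)
  : \bar R :=
  ereal_sup [set (- L * dotv w qstar)%:E | w in subdiff (fstar f) qstar].

Definition rhoconst (R : realType) (m : nat) (f : 'rV[R]_m -> R) (L : R)
  (qstar : 'rV[R]_m) : R := Num.sqrt (fine (rho2 f L qstar)).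

(* Main.v *)
(* Let D k be the gap [inf (P(Omega_k)) - inf (P)], which equals
   [f^* qstar - f^* q_k], is nonnegative and nonincreasing. Smoothness of [f]
   makes [f^*] strongly convex, so [|q_k - qstar|^2 <= 8 L D k] and
   [|q_(k+1) - q_k|^2 <= 8 L (D k - D (k+1))]. Fenchel duality for the atomic
   solution gives [D k <= |mustar| (max |A^* q_k| - 1)], with [L |mustar| <= rho^2].
   Let [y_k] be a global maximizer of [|A^* q_k|]; it enters Omega_(k+1). First,
   [D k <= const |q_(k+1) - q_k|] forces D to 0. Then all points of [X_k] are
   within [B sqrt (D k)] of xi, by concavity of [|A^* qstar|] near xi. Among enough
   consecutive [y_j], two, say [j < l], are much closer than that (pigeonhole);
   as [|A^* q_l (y_j)| <= 1] and [y_l] is critical for [A^* q_l], the value at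
   [y_l] exceeds 1 by at most [const |y_j - y_l|^2], so [D l <= e^-2 D k].
   The index k0 may depend on all the data, hence only the number of steps per
   contraction carries the dependence on the constants: the other two are 1. *)

Require Import Defs.
From HB Require Import structures.
From mathcomp Require Import all_boot all_order all_algebra.
From mathcomp Require Import all_classical all_reals all_analysis.
From mathcomp Require Import measurable_realfun.
From mathcomp Require Import ring lra.
Import Order.TTheory GRing.Theory Num.Theory.
Import numFieldNormedType.Exports.
Local Open Scope classical_set_scope.
Local Open Scope ring_scope.

(** * Euclidean inner product and norm on row vectors *)

Section Euclidean.
Context {R : realType} {n : nat}.
Implicit Types (u v w : 'rV[R]_n) (c : R).

Lemma dotvC u v : dotv u v = dotv v u.
Proof. by apply: eq_bigr => i _; rewrite mulrC. Qed.

Lemma dotvDl u v w : dotv (u + v) w = dotv u w + dotv v w.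
Proof. by rewrite -big_split; apply: eq_bigr => i _; rewrite mxE mulrDl. Qed.

Lemma dotvZl c u v : dotv (c *: u) v = c * dotv u v.
Proof. by rewrite mulr_sumr; apply: eq_bigr => i _; rewrite mxE mulrA. Qed.

Lemma dotvNl u v : dotv (- u) v = - dotv u v.
Proof. by rewrite -scaleN1r dotvZl mulN1r. Qed.

Lemma dotvDr u v w : dotv u (v + w) = dotv u v + dotv u w.
Proof. by rewrite dotvC dotvDl !(dotvC u). Qed.

Lemma dotvZr c u v : dotv u (c *: v) = c * dotv u v.
Proof. by rewrite dotvC dotvZl dotvC. Qed.

Lemma dotvNr u v : dotv u (- v) = - dotv u v.
Proof. by rewrite dotvC dotvNl dotvC. Qed.

Lemma norm2_ge0 u : 0 <= norm2 u.
Proof. exact: sqrtr_ge0. Qed.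

Lemma sqr_norm2_sum u : norm2 u ^+ 2 = \sum_(i < n) u 0 i ^+ 2.
Proof. by rewrite sqr_sqrtr// sumr_ge0// => i _; rewrite sqr_ge0. Qed.

Lemma sqr_norm2 u : norm2 u ^+ 2 = dotv u u.
Proof. by rewrite sqr_norm2_sum; apply: eq_bigr => i _; rewrite expr2. Qed.

Lemma norm2Z c u : norm2 (c *: u) = `|c| * norm2 u.
Proof.
apply/eqP; rewrite -(@eqrXn2 _ 2)// ?mulr_ge0 ?norm2_ge0//.
by rewrite exprMn !sqr_norm2 dotvZl dotvZr real_normK ?num_real// expr2 mulrA.
Qed.

Lemma norm2N u : norm2 (- u) = norm2 u.
Proof. by rewrite -scaleN1r norm2Z normrN1 mul1r. Qed.

Lemma norm2_0 : norm2 (0 : 'rV[R]_n) = 0.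
Proof. by rewrite -(scale0r 0) norm2Z normr0 mul0r. Qed.

Lemma abs_coord_le_norm2 u i : `|u 0 i| <= norm2 u.
Proof.
rewrite -(@ler_pXn2r _ 2)// ?nnegrE ?norm2_ge0// sqr_norm2_sum.
rewrite real_normK ?num_real// (bigD1 i)//= lerDl sumr_ge0// => j _.
exact: sqr_ge0.
Qed.

Lemma norm2_eq0 u : norm2 u = 0 -> u = 0.
Proof.
move=> u0; apply/rowP => i; rewrite mxE; apply/eqP.
by rewrite -normr_le0 -u0 abs_coord_le_norm2.
Qed.

(** Cauchy-Schwarz: expand the square of [b *: u - a *: v] with [a], [b] the two norms. The zero
    cases are treated apart because the result is cancelled by [a * b]. *)
Lemma dotv_le u v : dotv u v <= norm2 u * norm2 v.
Proof.
set a := norm2 u; set b := norm2 v.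
have a0 : 0 <= a by exact: norm2_ge0.
have b0 : 0 <= b by exact: norm2_ge0.
have [/norm2_eq0 ->|an0] := eqVneq a 0.
  by rewrite -[in leLHS](scale0r 0) dotvZl mul0r mulr_ge0.
have [/norm2_eq0 ->|bn0] := eqVneq b 0.
  by rewrite dotvC -[in leLHS](scale0r 0) dotvZl mul0r mulr_ge0.
have ab0 : 0 < a * b by rewrite mulr_gt0 ?lt_def ?an0 ?bn0.
have := sqr_ge0 (norm2 (b *: u - a *: v)).
rewrite sqr_norm2 dotvDl !dotvDr !dotvNl !dotvNr !dotvZl !dotvZr (dotvC v u).
rewrite -!sqr_norm2 -/a -/b => h.
rewrite -(ler_pM2l ab0); nra.
Qed.

Lemma abs_dotv_le u v : `|dotv u v| <= norm2 u * norm2 v.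
Proof.
rewrite ler_norml dotv_le andbT lerNl -dotvNl.
by rewrite (le_trans (dotv_le _ _))// norm2N.
Qed.

Lemma norm2D u v : norm2 (u + v) <= norm2 u + norm2 v.
Proof.
rewrite -(@ler_pXn2r _ 2)// ?nnegrE ?addr_ge0 ?norm2_ge0//.
rewrite sqr_norm2 dotvDl !dotvDr (dotvC v u) -!sqr_norm2.
have := dotv_le u v; nra.
Qed.

Lemma norm2_le_coord u c : 0 <= c -> (forall i, `|u 0 i| <= c) ->
  norm2 u ^+ 2 <= n%:R * c ^+ 2.
Proof.
move=> c0 uc; rewrite sqr_norm2_sum.
rewrite -[n in n%:R]card_ord mulr_natl -sumr_const ler_sum// => i _.
by rewrite -real_normK ?num_real// ler_pXn2r ?nnegrE.
Qed.

End Euclidean.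

(** * Mean value theorem along a line, gradients and segments *)

Section DirectionalDerivatives.
Context {R : realType} {n : nat}.
Implicit Types (g h : 'rV[R]_n -> R) (x u v : 'rV[R]_n) (Om : set 'rV[R]_n).

(** The two difference quotients are literally the same function of the increment, so derivability
    and the value transfer together. *)
Lemma is_derive_line g x v (t : R) : derivable g (x + t *: v) v ->
  is_derive t 1 (fun s => g (x + s *: v)) ('D_v g (x + t *: v)).
Proof.
have E : (fun h : R => h^-1 *: (((fun s => g (x + s *: v)) \o shift t) (h *: 1)
     - g (x + t *: v)))
  = (fun h : R => h^-1 *: ((g \o shift (x + t *: v)) (h *: v) - g (x + t *: v))).
  apply/funext => h /=; congr (_ *: (g _ - _)).
  by rewrite [h%:A]mulr1 scalerDl addrCA.
by move=> gd; split; rewrite /derivable /derive E.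
Qed.

Lemma MVT_line g x v :
  (forall t : R, 0 <= t <= 1 -> derivable g (x + t *: v) v) ->
  exists2 t : R, 0 <= t <= 1 & g (x + v) - g x = 'D_v g (x + t *: v).
Proof.
move=> gd.
have [| |t] := @MVT_segment R (fun s => g (x + s *: v))
    (fun s => 'D_v g (x + s *: v)) 0 1 ler01.
- move=> t /[!in_itv]/= /andP[t0 t1].
  by apply: is_derive_line; apply: gd; rewrite !ltW.
- apply: derivable_within_continuous => t /[!in_itv]/= t01.
  by have [] := is_derive_line _ _ _ _ (gd t t01).
rewrite in_itv/= => t01; rewrite scale1r scale0r addr0 subr0 mulr1 => E.
by exists t.
Qed.

Lemma deriveE_sum g x v : differentiable g x ->
  'D_v g x = \sum_i v 0 i * pderiv i g x.
Proof.
move=> gd; rewrite deriveE// [in LHS](row_sum_delta v) linear_sum.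
by apply: eq_bigr => i _; rewrite linearZ/= /pderiv deriveE.
Qed.

Lemma deriveE_grad g x v : differentiable g x -> 'D_v g x = dotv v (grad g x).
Proof.
by move=> gd; rewrite deriveE_sum//; apply: eq_bigr => i _; rewrite !mxE.
Qed.

Lemma convex_set_segment Om x v (t : R) : convex_set Om -> Om x -> Om (x + v) ->
  0 <= t <= 1 -> Om (x + t *: v).
Proof.
move=> Omc Ox Oxv /andP[t0 t1].
have := Omc (x + v) x (Itv01 t0 t1).
rewrite !inE => /(_ Oxv Ox); congr (Om _).
rewrite /conv/= /unstable.onem scalerDr scalerBl scale1r addrC addrA.
by rewrite subrK.
Qed.

End DirectionalDerivatives.

(** * Strong convexity of the conjugate of a function with Lipschitz gradient *)

Section Conjugate.
Context {R : realType} {m : nat} (f : 'rV[R]_m -> R) (L : R).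
Implicit Types (p q z h : 'rV[R]_m).

Lemma fenchel_young q z : ((dotv q z - f z)%:E <= fstar f q)%E.
Proof. by apply: ereal_sup_ubound; exists z. Qed.

Lemma fstar_fin_num q (c : R) : (fstar f q <= c%:E)%E ->
  fstar f q \is a fin_num.
Proof.
move=> qc; rewrite fin_numElt (lt_le_trans (ltNyr _) (fenchel_young q 0)).
exact: le_lt_trans qc (ltry _).
Qed.

Lemma fstar0_le (b : R) : (forall z, b <= f z) -> (fstar f 0 <= (- b)%:E)%E.
Proof.
move=> fb; apply: ge_ereal_sup => _ [z _ <-].
by rewrite lee_fin -(scale0r 0) dotvZl mul0r add0r lerN2.
Qed.

Hypothesis f_diff : forall z, differentiable f z.
Hypothesis L_gt0 : 0 < L.
Hypothesis grad_lip :
  forall z w, norm2 (grad f z - grad f w) <= L * norm2 (z - w).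

(** Mean value theorem plus Cauchy-Schwarz. Since the gradient is evaluated at an intermediate point
    rather than integrated, the quadratic coefficient is [L] and not [L / 2]. *)
Lemma descent z h : f (z + h) <= f z + dotv h (grad f z) + L * norm2 h ^+ 2.
Proof.
have [t /andP[t0 t1]] :
    exists2 t : R, 0 <= t <= 1 & f (z + h) - f z = 'D_h f (z + t *: h).
  by apply: MVT_line => t _; exact: diff_derivable.
rewrite deriveE_grad// => /eqP; rewrite subr_eq [_ + f z]addrC => /eqP ->.
rewrite -addrA lerD2l -lerBlDl -dotvNr -dotvDr.
apply: le_trans (dotv_le _ _) _.
rewrite expr2 mulrCA ler_wpM2l ?norm2_ge0//.
apply: le_trans (grad_lip _ _) _.
by rewrite addrC addKr norm2Z ler_pM2l// ger0_norm// ler_piMl ?norm2_ge0.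
Qed.

(* Test the supremum defining [fstar f] at [z + h] and [z - h] with
   [h = (p - q) / (4 L)]; the gain over the midpoint is the descent bound. *)
Lemma fstar_midpoint p q (a b : R) : fstar f p = a%:E -> fstar f q = b%:E ->
  (fstar f (2^-1 *: (p + q)) <=
     ((a + b) / 2 - norm2 (p - q) ^+ 2 / (16 * L))%:E)%E.
Proof.
move=> pa qb; apply: ge_ereal_sup => _ [z _ <-]; rewrite lee_fin.
pose c := (4 * L)^-1; pose h := c *: (p - q).
have cL : c * L = 4^-1 by rewrite /c; field; rewrite gt_eqF.
have ha := fenchel_young p (z + h); rewrite pa lee_fin in ha.
have hb := fenchel_young q (z - h); rewrite qb lee_fin in hb.
have fa := descent z h.
have fb := descent z (- h).
move: ha hb fa fb; rewrite norm2N !dotvDr !dotvNr dotvNl.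
have -> : norm2 h ^+ 2 = c ^+ 2 * norm2 (p - q) ^+ 2.
  by rewrite norm2Z exprMn real_normK ?num_real.
have hE : dotv p h - dotv q h = c * norm2 (p - q) ^+ 2.
  by rewrite sqr_norm2 -dotvNl -dotvDl dotvZr.
have -> : norm2 (p - q) ^+ 2 / (16 * L) = c / 4 * norm2 (p - q) ^+ 2.
  by rewrite /c; field; rewrite gt_eqF.
have -> : L * (c ^+ 2 * norm2 (p - q) ^+ 2) = c / 4 * norm2 (p - q) ^+ 2.
  by rewrite -[c / 4]/(c * 4^-1) -cL; ring.
rewrite (dotvZl 2^-1) (dotvDl p q); lra.
Qed.

(** Minimality of [p] is tested at the midpoint only, so [K] has to contain just that point: [a] is
    at most [(a + b) / 2] minus the strong convexity gain. *)
Lemma fstar_quadratic_growth (K : set 'rV[R]_m) p q (a b : R) :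
  K (2^-1 *: (p + q)) ->
  (forall q', K q' -> (fstar f p <= fstar f q')%E) ->
  fstar f p = a%:E -> fstar f q = b%:E ->
  norm2 (q - p) ^+ 2 <= 8 * L * (b - a).
Proof.
move=> Kpq pmin pa qb.
have := le_trans (pmin _ Kpq) (fstar_midpoint _ _ _ _ pa qb).
rewrite pa lee_fin -(norm2N (p - q)) opprB.
set D := norm2 _ ^+ 2 => h.
have {}h : D / (16 * L) <= (b - a) / 2 by lra.
rewrite ler_pdivrMr in h; last by rewrite mulr_gt0.
lra.
Qed.

End Conjugate.

(** * Integration against a finite combination of Dirac masses *)

Section AtomicIntegral.
Context {dT : measure_display} {T : measurableType dT} {R : realType} {s : nat}.
Variables (mu : {measure set T -> \bar R}) (c : 'I_s -> R) (xi : 'I_s -> T).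
Hypothesis c_ge0 : forall i, 0 <= c i.
Hypothesis muE : forall A, measurable A ->
  mu A = (\sum_(i < s | xi i \in A) c i)%:E.
Context {D : set T}.
Hypothesis mD : measurable D.
Hypothesis xiD : forall i, D (xi i).

(** [msum] takes a sequence indexed by [nat], so the family over ['I_s] is extended by zero; the sum
    stops at [s] and never meets the padding. *)
Let atom (n : nat) : {measure set T -> \bar R} :=
  if insub n is Some i then mscale (NngNum (c_ge0 i)) (dirac (xi i))
  else mzero.

Lemma ge0_integral_atomic (g : T -> R) : measurable_fun D g ->
  (forall x, 0 <= g x) ->
  (\int[mu]_(x in D) (g x)%:E)%E = (\sum_(i < s) c i * g (xi i))%:E.
Proof.
move=> mg g0.
have mg' : measurable_fun D (EFin \o g) by exact/measurable_EFinP.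
rewrite (eq_measure_integral (msum atom s)) => [|A mA AD]; last first.
  rewrite muE// /msum -sumEFin [LHS]big_mkcond; apply: eq_bigr => i _.
  rewrite /atom valK /= /mscale /= diracE.
  by case: (xi i \in A); rewrite ?mule1 ?mule0.
rewrite ge0_integral_measure_sum// => [|x _]; last by rewrite lee_fin.
rewrite -sumEFin; apply: eq_bigr => i _; rewrite /atom valK.
rewrite ge0_integral_mscale// => [|x _]; last by rewrite lee_fin.
rewrite integral_dirac//= diracE mem_set ?mul1e//.
Qed.

Lemma integral_atomic (g : T -> R) : measurable_fun D g ->
  (\int[mu]_(x in D) (g x)%:E)%E = (\sum_(i < s) c i * g (xi i))%:E.
Proof.
move=> mg; rewrite -[X in integral _ _ X]/(EFin \o g) integralE funerpos funerneg.
have mp := measurable_funrpos mg; have mn := measurable_funrneg mg.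
have p0 x : 0 <= (g^\+)%R x by rewrite /funrpos le_max lexx orbT.
have n0 x : 0 <= (g^\-)%R x by rewrite /funrneg le_max lexx orbT.
rewrite (ge0_integral_atomic _ mp p0) (ge0_integral_atomic _ mn n0).
rewrite -EFinB -sumrB; congr _%:E; apply: eq_bigr => i _.
by rewrite -mulrBr -[in RHS](funrposBneg g).
Qed.

End AtomicIntegral.

(** * Jordan parts, total variation and integrals of an atomic signed measure *)

Section AtomicCharge.
Context {R : realType} {d s : nat}.
Variables (nu : smeasure R d) (xi : 'I_s -> 'rV[R]_d) (alpha : 'I_s -> R).
Hypothesis nuE : forall A : set (borelV R d), measurable A ->
  nu A = (\sum_(i < s | (xi i : borelV R d) \in A) alpha i)%:E.
Hypothesis xi_inj : injective xi.

(** [P] and [N] are the very Hahn sets chosen inside [mpos], [mneg] and [tvar], so these measures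
    can be computed without comparing decompositions. *)
Let P : set (borelV R d) := (projT1 (cid (hahn_ex nu))).1.
Let N : set (borelV R d) := (projT1 (cid (hahn_ex nu))).2.
Let PN : hahn_decomposition nu P N := hahn_spec nu.

Lemma borelV_open (U : set 'rV[R]_d) : open U ->
  measurable (U : set (borelV R d)).
Proof. by move=> Uo; exact: sub_sigma_algebra. Qed.

Lemma borelV_set1 (x : 'rV[R]_d) : measurable ([set x] : set (borelV R d)).
Proof.
rewrite -[X in measurable X]setCK; apply: measurableC; apply: borelV_open.
by apply: closed_openC; apply: accessible_closed_set1; exact: hausdorff_accessible.
Qed.

Let nu_xi i : nu ([set xi i] : set (borelV R d)) = (alpha i)%:E.
Proof.
rewrite nuE; last exact: borelV_set1.
congr _%:E; rewrite (bigD1 i) /=; last by rewrite inE.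
rewrite big1 ?addr0// => j /andP[/set_mem /xi_inj -> /eqP//].
Qed.

Let alpha_pos i : P (xi i) -> 0 <= alpha i.
Proof.
move=> Pi; case: PN => -[_ /(_ [set xi i])] + _ _ _.
by rewrite nu_xi lee_fin; apply => [|_ ->//]; exact: borelV_set1.
Qed.

Let alpha_neg i : N (xi i) -> alpha i <= 0.
Proof.
move=> Pi; case: PN => _ [_ /(_ [set xi i])] + _ _.
by rewrite nu_xi lee_fin; apply => [|_ ->//]; exact: borelV_set1.
Qed.

(** Testing the Hahn sets on singletons gives the sign of each weight; as an atom lies in exactly
    one of [P] and [N], these are the positive and negative parts of [alpha i]. *)
Let cpos i := if (xi i : borelV R d) \in P then alpha i else 0.
Let cneg i := if (xi i : borelV R d) \in N then - alpha i else 0.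

Let cpos_ge0 i : 0 <= cpos i.
Proof. by rewrite /cpos; case: ifPn => // /set_mem/alpha_pos. Qed.

Let cneg_ge0 i : 0 <= cneg i.
Proof.
by rewrite /cneg; case: ifPn => // /set_mem/alpha_neg; rewrite oppr_ge0.
Qed.

Let cposneg i : cpos i - cneg i = alpha i /\ cpos i + cneg i = `|alpha i|.
Proof.
case: PN => _ _ PUN PIN; rewrite /cpos /cneg.
case: ifPn => [/set_mem Pi|]; case: ifPn => [/set_mem Ni|].
- by have : (P `&` N) (xi i) by []; rewrite PIN.
- by rewrite subr0 addr0 ger0_norm// alpha_pos.
- by rewrite opprK !add0r ler0_norm// alpha_neg.
- rewrite !notin_setE => Ni Pi.
  by have : (P `|` N) (xi i) by [rewrite PUN]; case.
Qed.

Let mposE A : measurable A ->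
  mpos nu A = (\sum_(i < s | (xi i : borelV R d) \in A) cpos i)%:E.
Proof.
move=> mA; rewrite /mpos jordan_posE cjordan_posE /crestr0 mem_set// /crestr.
rewrite nuE; last by apply: measurableI => //; case: PN => -[].
rewrite -big_mkcondr/=; congr _%:E; apply: eq_bigl => i.
by rewrite in_setI.
Qed.

Let mnegE A : measurable A ->
  mneg nu A = (\sum_(i < s | (xi i : borelV R d) \in A) cneg i)%:E.
Proof.
move=> mA; rewrite /mneg jordan_negE cjordan_negE /crestr0 mem_set// /crestr.
rewrite nuE; last by apply: measurableI => //; case: PN => _ -[].
rewrite -EFinN -sumrN -big_mkcondr/=; congr _%:E; apply: eq_bigl => i.
by rewrite in_setI.
Qed.

Lemma tvnorm_atomic : tvnorm nu = \sum_(i < s) `|alpha i|.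
Proof.
rewrite /tvnorm /tvar /charge_variation/= -/(mpos nu) -/(mneg nu).
rewrite mposE// mnegE// -EFinD/= -big_split/=.
by apply: eq_big => [i|i _]; [rewrite in_setT|case: (cposneg i)].
Qed.

Lemma sint_atomic (Om : set 'rV[R]_d) (g : 'rV[R]_d -> R) : open Om ->
  (forall i, Om (xi i)) ->  measurable_fun (Om : set (borelV R d)) g ->
  sint Om nu g = \sum_(i < s) alpha i * g (xi i).
Proof.
move=> Oo Oxi mg; rewrite /sint.
rewrite (integral_atomic _ _ _ cpos_ge0 mposE (borelV_open _ Oo) Oxi)//.
rewrite (integral_atomic _ _ _ cneg_ge0 mnegE (borelV_open _ Oo) Oxi)//=.
rewrite -sumrB; apply: eq_bigr => i _; rewrite -mulrBl.
by case: (cposneg i) => ->.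
Qed.

End AtomicCharge.

(** Open rays generate the Borel sets of the line, and their preimages intersected with the open set
    [Om] are open. *)
Lemma borelV_measurable_fun (R : realType) (d : nat) (Om : set 'rV[R]_d)
    (g : 'rV[R]_d -> R) : open Om ->
  (forall x, Om x -> {for x, continuous g}) ->
  measurable_fun (Om : set (borelV R d)) g.
Proof.
move=> Oo gc; apply: (measurability _ (RGenOInfty.measurableE R)).
move=> _ [_ [r ->] <-]; apply: borelV_open.
rewrite openE => x [Ox]; rewrite /= in_itv/= andbT => rx.
apply: filterI; first exact: open_nbhs_nbhs.
apply: (gc x Ox).
by apply: open_nbhs_nbhs; split => //=; rewrite in_itv/= rx.
Qed.

(** * Twice differentiable functions on an open set, and their Hessians *)

Lemma near_eq_differentiable (R : numFieldType) (V W : normedModType R)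
    (f g : V -> W) (x : V) :
  {near x, f =1 g} -> differentiable f x -> differentiable g x.
Proof.
move=> fg /diff_locallyP[dc fE].
have gE : g \o shift x = cst (g x) + 'd f x +o_ 0 id.
  apply/eqaddoP => e e0; move/eqaddoP : fE => /(_ e e0).
  apply: filter_app.
  have : \forall h \near 0, f (h + x) = g (h + x).
    by move/nbhs0P : (fg); apply: filterS => h; rewrite addrC.
  apply: filterS => h /= hE.
  by rewrite !fctE /= hE (nbhs_singleton fg).
by apply/diff_locallyP; rewrite (diff_unique dc gE).
Qed.

Section TwiceDifferentiable.
Context {R : realType} {n : nat}.
Implicit Types (g h : 'rV[R]_n -> R) (x u v : 'rV[R]_n) (U : set 'rV[R]_n).

(** A class that supports second-order mean value arguments and is stable under sums, scaling and,
    away from zeros, absolute values. *)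
Definition twice_diff U g :=
  (forall x, U x -> differentiable g x) /\
  (forall v x, U x -> differentiable ('D_v g) x).

Lemma C2_on_twice_diff U g : C2_on U g -> twice_diff U g.
Proof. by case. Qed.

Lemma eq_twice_diff U g h : open U -> (forall x, U x -> h x = g x) ->
  twice_diff U g -> twice_diff U h.
Proof.
move=> Uo gh [g1 g2]; split=> [x Ux|v x Ux].
  apply: near_eq_differentiable (g1 x Ux); near=> y; apply/esym/gh.
  by near: y; exact: open_nbhs_nbhs.
apply: near_eq_differentiable (g2 v x Ux); near=> y.
apply: near_eq_derive; near=> z; apply/esym/gh; near: z.
by apply: open_nbhs_nbhs; split => //; near: y; exact: open_nbhs_nbhs.
Unshelve. all: by end_near. Qed.

Lemma twice_diffD U g h : open U -> twice_diff U g -> twice_diff U h ->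
  twice_diff U (g + h).
Proof.
move=> Uo [g1 g2] [h1 h2]; split=> [x Ux|v x Ux].
  by apply: differentiableD; [exact: g1|exact: h1].
apply: (@near_eq_differentiable _ _ _ ('D_v g + 'D_v h)); last first.
  by apply: differentiableD; [exact: g2|exact: h2].
near=> y; have Uy : U y by near: y; exact: open_nbhs_nbhs.
by rewrite deriveD//; apply: diff_derivable; [exact: g1|exact: h1].
Unshelve. all: by end_near. Qed.

Lemma twice_diffZ U g (c : R) : open U -> twice_diff U g ->
  twice_diff U (c \*: g).
Proof.
move=> Uo [g1 g2]; split=> [x Ux|v x Ux].
  by apply: differentiableZ; exact: g1.
apply: (@near_eq_differentiable _ _ _ (c \*: 'D_v g)); last first.
  by apply: differentiableZ; exact: g2.
near=> y; have Uy : U y by near: y; exact: open_nbhs_nbhs.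
by rewrite deriveZ//; apply: diff_derivable; exact: g1.
Unshelve. all: by end_near. Qed.

Lemma twice_diff_sum U m (g : 'I_m -> 'rV[R]_n -> R) : open U ->
  (forall i, twice_diff U (g i)) -> twice_diff U (\sum_i g i).
Proof.
move=> Uo gU; elim/big_ind : _ => //; last by move=> *; exact: twice_diffD.
split=> [x _|v x _]; first exact: differentiable_cst.
rewrite (_ : 'D_v _ = cst 0); first exact: differentiable_cst.
by apply/funext => y; rewrite derive_cst.
Qed.

Lemma open_pos U g : open U -> twice_diff U g ->
  open [set x | U x /\ 0 < g x].
Proof.
move=> Uo [g1 _]; rewrite openE => x [Ux gx]; apply: filterI.
  exact: open_nbhs_nbhs.
exact: cvgr_gt (differentiable_continuous (g1 x Ux)) _ gx.
Qed.

(** Around a point where [g] does not vanish, its absolute value is [c \*: g] with a constant sign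
    [c], on the open set where [c * g] is positive. *)
Lemma twice_diff_norm U g : open U -> twice_diff U g ->
  twice_diff [set x | U x /\ g x != 0] (fun x => `|g x|).
Proof.
move=> Uo gU.
have key c x : `|c| = 1 -> U x -> 0 < c * g x ->
    exists V, [/\ open V, V x & twice_diff V (fun x => `|g x|)].
  move=> c1 Ux cgx; exists [set x | U x /\ 0 < c * g x].
  have cgU := twice_diffZ _ _ c Uo gU.
  have Vo := open_pos _ _ Uo cgU.
  split => //; apply: (@eq_twice_diff _ (c \*: g) _ Vo) => [y [_ cgy]|].
    by rewrite -[LHS]mul1r -c1 -normrM gtr0_norm.
  by split=> [y [Uy _]|v y [Uy _]]; case: cgU => g1 g2; [exact: g1|exact: g2].
have {}key x : U x -> g x != 0 ->
    exists V, [/\ open V, V x & twice_diff V (fun x => `|g x|)].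
  move=> Ux; rewrite neq_lt => /orP[gx|gx].
    by apply: (key (- 1)) => //; rewrite ?normrN1// mulN1r oppr_gt0.
  by apply: (key 1) => //; rewrite ?normr1// mul1r.
split=> [x [Ux gx]|v x [Ux gx]]; have [V [Vo Vx [V1 V2]]] := key x Ux gx.
- exact: V1.
- exact: V2.
Qed.

(** The inner derivative is expanded into partial derivatives on a whole neighbourhood of [x], so
    that the outer derivative may be applied to the expansion. *)
Lemma hess_twice_diffE U g x u v : open U -> twice_diff U g -> U x ->
  'D_u ('D_v g) x = (u *m hess g x *m v^T) 0 0.
Proof.
move=> Uo [g1 g2] Ux.
rewrite (@near_eq_derive _ _ _ _ (\sum_(j < n) (v 0 j \*: pderiv j g))); last first.
  near=> y; rewrite deriveE_sum; last first.
    by apply: g1; near: y; exact: open_nbhs_nbhs.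
  by rewrite fct_sumE.
have gd j : differentiable (pderiv j g) x by exact: g2.
rewrite derive_sum => [|j]; last by apply: derivableZ; exact: diff_derivable.
rewrite mxE; apply: eq_bigr => j _.
rewrite deriveZ ?deriveE_sum//; last exact: diff_derivable.
rewrite !mxE [LHS]mulrC; congr (_ * _); apply: eq_bigr => i _.
by rewrite !mxE.
Unshelve. all: by end_near. Qed.

(* Two applications of the mean value theorem along [x, x + v]. *)
Lemma MVT_line2 U g x v : open U -> convex_set U -> twice_diff U g ->
  U x -> U (x + v) -> exists2 y, U y &
    `|g (x + v) - g x - 'D_v g x| <= `|'D_v ('D_v g) y|.
Proof.
move=> Uo Uc [g1 g2] Ux Uxv.
have seg t : 0 <= t <= 1 -> U (x + t *: v) by exact: convex_set_segment.
have [t t01 ->] : exists2 t : R, 0 <= t <= 1 &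
    g (x + v) - g x = 'D_v g (x + t *: v).
  by apply: MVT_line => t t01; apply/diff_derivable/g1/seg.
have [r r01 E] : exists2 r : R, 0 <= r <= 1 &
   'D_v g (x + t *: v) - 'D_v g x = 'D_(t *: v) ('D_v g) (x + r *: (t *: v)).
  apply: (MVT_line ('D_v g) x (t *: v)) => r r01; apply: diff_derivable; apply: g2.
  rewrite scalerA; apply: seg; move: t01 r01 => /andP[t0 t1] /andP[r0 r1].
  by rewrite mulr_ge0//= mulr_ile1.
have Uy : U (x + r *: (t *: v)).
  rewrite scalerA; apply: seg; move: t01 r01 => /andP[t0 t1] /andP[r0 r1].
  by rewrite mulr_ge0//= mulr_ile1.
exists (x + r *: (t *: v)) => //; rewrite E.
rewrite !deriveE; try exact: g2.
rewrite linearZ/= normrM; move: t01 => /andP[t0 t1].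
by rewrite ger0_norm// ler_piMl.
Qed.

End TwiceDifferentiable.

(** * Fermat's rule for local maximizers of an absolute value *)

Section CriticalPoints.
Context {R : realType} {n : nat}.
Implicit Types (g : 'rV[R]_n -> R) (x v : 'rV[R]_n) (U : set 'rV[R]_n).

Lemma near_line (P : set 'rV[R]_n) x v : nbhs x P ->
  \forall t \near (0 : R), P (x + t *: v).
Proof. by move=> /nbhs0P /near0Z; exact. Qed.

Lemma derive_line_max g x v :
  (\forall t \near (0 : R), g (x + t *: v) <= g x) ->
  (\forall t \near (0 : R), derivable g (x + t *: v) v) -> 'D_v g x = 0.
Proof.
move=> gmax gder.
have : nbhs (0 : R) [set t | g (x + t *: v) <= g x /\
    derivable g (x + t *: v) v] by exact: filterI.
move=> /nbhs_ballP[e /= e0 He].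
have {}He (t : R) : - e < t < e ->
    g (x + t *: v) <= g x /\ derivable g (x + t *: v) v.
  by move=> te; apply: He; rewrite -ball_normE/= sub0r normrN ltr_norml.
have := @derive1_at_max R (fun s => g (x + s *: v)) (- e) e 0.
case.
- by rewrite ge0_cp// ltW.
- move=> t; rewrite in_itv/= => /He[_] td.
  by have [] := is_derive_line _ _ _ _ td.
- by rewrite in_itv/= oppr_lt0 e0.
- by move=> t; rewrite in_itv/= scale0r addr0 => /He[].
have g0 : derivable g (x + 0 *: v) v by apply: (He 0 _).2; rewrite oppr_lt0 e0.
by have [_ +] := is_derive_line _ _ _ _ g0; rewrite scale0r addr0 => ->.
Qed.

Lemma open_neq0 U g : open U -> twice_diff U g ->
  open [set x | U x /\ g x != 0].
Proof.
move=> Uo gU.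
rewrite (_ : [set x | _] = [set x | U x /\ 0 < g x] `|`
                           [set x | U x /\ 0 < (-1 \*: g) x]).
  by apply: openU; apply: open_pos => //; exact: twice_diffZ.
apply/seteqP; split=> x /=; rewrite [_ *: _]mulN1r oppr_gt0.
  by move=> [Ux]; rewrite neq_lt => /orP[]; [right|left].
by case=> -[Ux gx]; split => //; rewrite ?(gt_eqF gx) ?(lt_eqF gx).
Qed.

(** The sign of [g] is constant near [x]; absolute values on both sides make it disappear. *)
Lemma derive_norm U g x v : open U -> twice_diff U g -> U x -> g x != 0 ->
  `|'D_v (fun y => `|g y|) x| = `|'D_v g x|.
Proof.
move=> Uo gU Ux gx.
have dg : derivable g x v by apply: diff_derivable; case: gU => + _; exact.
have cg := differentiable_continuous (gU.1 x Ux).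
move: gx; rewrite neq_lt => /orP[gx|gx].
  rewrite (@near_eq_derive _ _ _ _ (- g)).
    by rewrite deriveN// normrN.
  near=> y; rewrite ltr0_norm//; near: y; exact: cvgr_lt cg _ gx.
rewrite (@near_eq_derive _ _ _ _ g)//.
near=> y; rewrite gtr0_norm//; near: y; exact: cvgr_gt cg _ gx.
Unshelve. all: by end_near. Qed.

(** Near [x] the absolute value of [g] is differentiable, so the one-variable Fermat rule applies to
    it along the line in direction [v]. *)
Lemma local_max_critical U g x v : open U -> twice_diff U g ->
  local_max U (fun y => `|g y|) x -> g x != 0 -> 'D_v g x = 0.
Proof.
move=> Uo gU [Ux [e [e0 gmax]]] gx.
have Wo := open_neq0 _ _ Uo gU.
have [g1 _] := twice_diff_norm _ _ Uo gU.
apply/eqP; rewrite -normr_eq0 -(derive_norm _ _ _ _ Uo gU Ux gx) normr_eq0.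
(* The added 1 allows a division that also covers [v = 0]. *)
have v1 : 0 < norm2 v + 1 by rewrite ltr_wpDl// norm2_ge0.
apply/eqP; apply: derive_line_max.
  near=> t; apply: gmax.
    by near: t; apply: near_line; exact: open_nbhs_nbhs.
  rewrite addrC addKr norm2Z.
  apply: (@le_lt_trans _ _ (`|t| * (norm2 v + 1))).
    by rewrite ler_wpM2l// lerDl.
  rewrite -ltr_pdivlMr//.
  near: t; apply/nbhs_ballP; exists (e / (norm2 v + 1)); first by rewrite /= divr_gt0.
  by move=> t; rewrite -ball_normE/= sub0r normrN.
near=> t; apply/diff_derivable/g1; near: t.
by apply: near_line; exact: open_nbhs_nbhs.
Unshelve. all: by end_near. Qed.

End CriticalPoints.

(** * Continuous functions vanishing at the boundary attain their maximum modulus *)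

Section VanishingAtTheBoundary.
Context {R : realType} {n : nat} (Om : set 'rV[R]_n).
Implicit Types g h : 'rV[R]_n -> R.

Lemma C0_onD g h : C0_on Om g -> C0_on Om h -> C0_on Om (g + h).
Proof.
move=> [gc g0] [hc h0]; split=> [x Ox|e e0].
  by apply: continuousD; [exact: gc|exact: hc].
have [K [Kc KO Kg]] := g0 _ (divr_gt0 e0 (ltr0n _ 2)).
have [K' [Kc' KO' Kh]] := h0 _ (divr_gt0 e0 (ltr0n _ 2)).
exists (K `|` K'); split => [||x Ox].
- exact: compactU.
- by move=> x [/KO|/KO'].
- move=> /not_orP[/(Kg _ Ox) ? /(Kh _ Ox) ?].
  by rewrite (le_lt_trans (ler_normD _ _))// (splitr e) ltrD.
Qed.

Lemma C0_onZ g (c : R) : C0_on Om g -> C0_on Om (c \*: g).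
Proof.
move=> [gc g0]; split=> [x Ox|e e0].
  by apply: continuousZl_tmp; exact: gc.
have c1 : 0 < `|c| + 1 by rewrite ltr_wpDl.
have [K [Kc KO Kg]] := g0 _ (divr_gt0 e0 c1).
exists K; split => // x Ox /(Kg _ Ox); rewrite ltr_pdivlMr// => h.
by rewrite /= normrM (le_lt_trans _ h)// mulrC ler_wpM2l// lerDl.
Qed.

Lemma C0_on_sum m (g : 'I_m -> 'rV[R]_n -> R) :
  (forall i, C0_on Om (g i)) -> C0_on Om (\sum_i g i).
Proof.
move=> gO; elim/big_ind : _ => //; last by move=> *; exact: C0_onD.
split=> [x _|e e0]; first exact: cst_continuous.
by exists set0; split => [|//|x _ _]; [exact: compact0|rewrite normr0].
Qed.

(** Take the compact set for the level [c]: it contains [x0], and outside it the values are below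
    the one at [x0], so the maximum over it is global. *)
Lemma C0_on_max g (c : R) x0 : C0_on Om g -> 0 < c -> Om x0 -> c < `|g x0| ->
  exists2 y, Om y & forall x, Om x -> `|g x| <= `|g y|.
Proof.
move=> [gc g0] c0 Ox0 gx0; have [K [Kc KO Kg]] := g0 _ c0.
have Kx0 : K x0.
  by apply: contrapT => /(Kg _ Ox0) /(lt_trans gx0); rewrite ltxx.
have [||y /set_mem Ky ymax] := @EVT_max_rV R n (fun x => `|g x|) K _ Kc.
- by exists x0.
- apply: continuous_in_subspaceT => x /set_mem/KO/gc gx.
  apply: (@continuous_comp _ _ _ g Num.norm); [exact: gx|exact: norm_continuous].
exists y => [|x Ox]; first exact: KO.
have [Kx|Kx] := pselect (K x); first by apply: ymax; rewrite inE.
rewrite (le_trans (ltW (Kg _ Ox Kx)))// (le_trans (ltW gx0))//.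
by apply: ymax; rewrite inE.
Qed.

Lemma C0_on_bounded g : C0_on Om g -> exists b, forall x, Om x -> `|g x| <= b.
Proof.
move=> gO; have [[x0 [Ox0 gx0]]|no] := pselect (exists x0, Om x0 /\ 1 < `|g x0|).
  have [y _ ymax] := C0_on_max _ _ _ gO ltr01 Ox0 gx0.
  by exists `|g y|.
exists 1 => x Ox; rewrite leNgt; apply/negP => gx.
by apply: no; exists x.
Qed.

End VanishingAtTheBoundary.
(** Also covers empty and unbounded sets, where [sup] has the default value 0. *)
Lemma sup_ge0 (R : realType) (E : set R) : (forall x, E x -> 0 <= x) -> 0 <= sup E.
Proof.
move=> E0; have [Es|/sup_out ->//] := pselect (has_sup E).
have [x Ex] := Es.1; rewrite (le_trans (E0 x Ex))//.
by apply: ub_le_sup => //; case: Es.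
Qed.

(** * Operator norm and quadratic forms *)

Section OperatorNorm.
Context {R : realType} {n : nat}.
Implicit Types (H : 'M[R]_n) (u v : 'rV[R]_n).

Lemma mulmx_formE H u v :
  (u *m H *m v^T) 0 0 = \sum_j (\sum_i u 0 i * H i j) * v 0 j.
Proof. by rewrite mxE; apply: eq_bigr => j _; rewrite !mxE. Qed.

Let forms H := [set r : R | exists u v : 'rV[R]_n,
  [/\ norm2 u <= 1, norm2 v <= 1 & r = (u *m H *m v^T) 0 0]].

Lemma opnorm2_has_sup H : has_sup (forms H).
Proof.
split.
  exists (((0 : 'rV[R]_n) *m H *m (0 : 'rV[R]_n)^T) 0 0), 0, 0.
  by rewrite norm2_0 ler01.
exists (\sum_j \sum_i `|H i j|) => _ [u [v [u1 v1 ->]]].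
rewrite mulmx_formE ler_sum// => j _; rewrite (le_trans (ler_norm _))// normrM.
rewrite (le_trans (ler_pM (normr_ge0 _) (normr_ge0 _) (ler_norm_sum _ _ _)
  (le_trans (abs_coord_le_norm2 v j) v1)))// mulr1 ler_sum// => i _.
by rewrite normrM ler_piMl// (le_trans (abs_coord_le_norm2 u i)).
Qed.

Lemma opnorm2_ge0 H : 0 <= opnorm2 H.
Proof.
apply: ub_le_sup; first by case: (opnorm2_has_sup H).
by exists 0, 0; rewrite norm2_0 ler01 !mul0mx mxE.
Qed.

Lemma opnorm2_ge H u v : norm2 u <= 1 -> norm2 v <= 1 ->
  (u *m H *m v^T) 0 0 <= opnorm2 H.
Proof.
move=> u1 v1; apply: ub_le_sup; first by case: (opnorm2_has_sup H).
by exists u, v.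
Qed.

Lemma opnorm2_le H (c : R) : (forall u v, norm2 u <= 1 -> norm2 v <= 1 ->
  (u *m H *m v^T) 0 0 <= c) -> opnorm2 H <= c.
Proof.
move=> Hc; apply: ge_sup; first by case: (opnorm2_has_sup H).
by move=> _ [u [v [u1 v1 ->]]]; exact: Hc.
Qed.

Lemma normalized u : exists2 w, norm2 w <= 1 & u = norm2 u *: w.
Proof.
have [/norm2_eq0 ->|u0] := eqVneq (norm2 u) 0.
  by exists 0; rewrite ?norm2_0 ?ler01// scaler0.
exists ((norm2 u)^-1 *: u); last by rewrite scalerA divff// scale1r.
by rewrite norm2Z ger0_norm ?invr_ge0 ?norm2_ge0// mulVf.
Qed.

(** As [opnorm2] ranges over two independent vectors, changing the sign of one of them turns the
    upper bound into the lower one. *)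
Lemma abs_form_le H u :
  `|(u *m H *m u^T) 0 0| <= opnorm2 H * norm2 u ^+ 2.
Proof.
have [w w1 uE] := normalized u.
rewrite [in leLHS]uE linearZ/= -!scalemxAl -scalemxAr 2!mxE mulrA -expr2.
rewrite normrM ger0_norm ?sqr_ge0// mulrC ler_wpM2r ?sqr_ge0// ler_norml.
rewrite opnorm2_ge// andbT lerNl.
rewrite (_ : - _ = ((- w) *m H *m w^T) 0 0).
  by rewrite opnorm2_ge// norm2N.
by rewrite !mulNmx [RHS]mxE.
Qed.

End OperatorNorm.

(** * Derivatives of [Astar] and their bounds by the kappa constants *)

Section Adjoint.
Context {R : realType} {d m : nat} (Om : set 'rV[R]_d).
Context (a : 'I_m -> 'rV[R]_d -> R).
Implicit Types (p q : 'rV[R]_m) (x u v : 'rV[R]_d).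
Hypothesis Om_open : open Om.
Hypothesis a_C0C2 : forall i, C0_on Om (a i) /\ C2_on Om (a i).

Lemma AstarE_dotv q x : Astar a q x = dotv q (\row_i a i x).
Proof. by apply: eq_bigr => i _; rewrite mxE. Qed.

Lemma AstarB p q x : Astar a (p - q) x = Astar a p x - Astar a q x.
Proof. by rewrite !AstarE_dotv dotvDl dotvNl. Qed.

Lemma AstarE_sum q : Astar a q = \sum_i (q 0 i \*: a i).
Proof. by apply/funext => x; rewrite fct_sumE. Qed.

Lemma twice_diff_Astar q : twice_diff Om (Astar a q).
Proof.
rewrite AstarE_sum; apply: twice_diff_sum => // i; apply: twice_diffZ => //.
by apply: C2_on_twice_diff; case: (a_C0C2 i).
Qed.

Lemma C0_on_Astar q : C0_on Om (Astar a q).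
Proof.
rewrite AstarE_sum; apply: C0_on_sum => // i; apply: C0_onZ => //.
by case: (a_C0C2 i).
Qed.

Lemma derive_Astar q v x : Om x ->
  'D_v (Astar a q) x = dotv q (\row_i 'D_v (a i) x).
Proof.
move=> Ox; have da i : derivable (a i) x v.
  by apply: diff_derivable; have [_ [+ _ _]] := a_C0C2 i; exact.
rewrite AstarE_sum derive_sum => [|i]; last exact: derivableZ.
by apply: eq_bigr => i _; rewrite deriveZ// mxE.
Qed.

Lemma derive2_Astar q u v x : Om x ->
  'D_u ('D_v (Astar a q)) x = dotv q (\row_i 'D_u ('D_v (a i)) x).
Proof.
move=> Ox; have da i : derivable ('D_v (a i)) x u.
  by apply: diff_derivable; have [_ [_ + _]] := a_C0C2 i; exact.
rewrite (@near_eq_derive _ _ _ _ (\sum_i (q 0 i \*: 'D_v (a i)))).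
  rewrite derive_sum => [|i]; last exact: derivableZ.
  by apply: eq_bigr => i _; rewrite deriveZ// mxE.
near=> y; rewrite derive_Astar; last by near: y; exact: open_nbhs_nbhs.
by rewrite fct_sumE; apply: eq_bigr => i _; rewrite mxE.
Unshelve. all: by end_near. Qed.

(** In the theorem [b] only influences the index [k0], so any positive bound serves. *)
Lemma Astar_bounded : exists2 b, 0 < b &
  forall q x, Om x -> `|Astar a q x| <= b * norm2 q.
Proof.
have /choice[b ab] : forall i, exists b, forall x, Om x -> `|a i x| <= b.
  by move=> i; apply: C0_on_bounded; case: (a_C0C2 i).
exists (1 + \sum_i `|b i|); first by rewrite ltr_wpDr// sumr_ge0.
move=> q x Ox; rewrite (le_trans (ler_norm_sum _ _ _))// mulrDl mul1r.
rewrite (@le_trans _ _ ((\sum_i `|b i|) * norm2 q))//; last first.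
  by rewrite lerDr norm2_ge0.
rewrite mulr_suml ler_sum// => i _; rewrite normrM mulrC ler_pM//.
  exact: le_trans (ab i x Ox) (ler_norm _).
exact: abs_coord_le_norm2.
Qed.

Hypothesis a_bounded : exists B : R, forall i x, Om x ->
  norm2 (grad (a i) x) <= B /\ opnorm2 (hess (a i) x) <= B.

(** Shows that the sets defining [kappa_grad] and [kappa_hess] are bounded above, without which
    their suprema would bound nothing. *)
Let dotv_row_le q (F : 'I_m -> R) (c : R) : 0 <= c -> norm2 q <= 1 ->
  (forall i, `|F i| <= c) -> dotv q (\row_i F i) <= m%:R * c.
Proof.
move=> c0 q1 Fc; rewrite -[m in m%:R]card_ord mulr_natl -sumr_const.
apply: ler_sum => i _; rewrite mxE (le_trans (ler_norm _))// normrM.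
by rewrite (le_trans _ (Fc i))// ler_piMl// (le_trans (abs_coord_le_norm2 _ _)).
Qed.

Lemma abs_derive_Astar_le q v x : Om x ->
  `|'D_v (Astar a q) x| <= kappa_grad Om a * norm2 q * norm2 v.
Proof.
move=> Ox; have [w w1 qE] := normalized q.
have [B aB] := a_bounded.
rewrite derive_Astar// [in leLHS]qE dotvZl -derive_Astar//.
rewrite normrM ger0_norm ?norm2_ge0// [leLHS]mulrC mulrAC ler_wpM2r ?norm2_ge0//.
rewrite deriveE_grad; last by case: (twice_diff_Astar w) => + _; exact.
rewrite (le_trans (abs_dotv_le _ _))// mulrC ler_wpM2r ?norm2_ge0//.
apply: ub_le_sup; last by exists w, x.
exists (m%:R * `|B|) => _ [p [y [p1 Oy ->]]].
set g := grad (Astar a p) y.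
(* The squared norm of the gradient is the derivative in the direction of the gradient itself; one
   factor is then cancelled. *)
have [->|g0] := eqVneq (norm2 g) 0; first by rewrite mulr_ge0.
rewrite -(@ler_pM2l _ (norm2 g)); last by rewrite lt_def g0 norm2_ge0.
rewrite -expr2 sqr_norm2 {2}/g -deriveE_grad; last first.
  by case: (twice_diff_Astar p) => + _; exact.
rewrite derive_Astar// mulrCA; apply: dotv_row_le => // [|i].
  by rewrite mulr_ge0 ?norm2_ge0.
rewrite deriveE_grad; last by have [_ [+ _ _]] := a_C0C2 i; exact.
rewrite (le_trans (abs_dotv_le _ _))// ler_wpM2l ?norm2_ge0//.
by have [+ _] := aB i y Oy; move=> /le_trans; apply; exact: ler_norm.
Qed.

Lemma kappa_grad_ge0 : 0 <= kappa_grad Om a.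
Proof. by apply: sup_ge0 => _ [p [y [_ _ ->]]]; exact: norm2_ge0. Qed.

Lemma kappa_hess_ge0 : 0 <= kappa_hess Om a.
Proof. by apply: sup_ge0 => _ [p [y [_ _ ->]]]; exact: opnorm2_ge0. Qed.

Lemma abs_derive2_Astar_le q v x : Om x ->
  `|'D_v ('D_v (Astar a q)) x| <= kappa_hess Om a * norm2 q * norm2 v ^+ 2.
Proof.
move=> Ox; have [w w1 qE] := normalized q.
have [B aB] := a_bounded.
have B0 i y : Om y -> opnorm2 (hess (a i) y) <= `|B|.
  by move=> Oy; have [_ /le_trans] := aB i y Oy; apply; exact: ler_norm.
rewrite derive2_Astar// [in leLHS]qE dotvZl -derive2_Astar//.
rewrite normrM ger0_norm ?norm2_ge0// [leLHS]mulrC mulrAC ler_wpM2r ?norm2_ge0//.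
rewrite (hess_twice_diffE _ _ _ _ _ Om_open (twice_diff_Astar w) Ox).
rewrite (le_trans (abs_form_le _ _))// ler_wpM2r ?sqr_ge0//.
apply: ub_le_sup; last by exists w, x.
exists (m%:R * `|B|) => _ [p [y [p1 Oy ->]]].
apply: opnorm2_le => u1 v1 hu hv.
rewrite -(hess_twice_diffE _ _ _ _ _ Om_open (twice_diff_Astar p) Oy).
rewrite derive2_Astar//; apply: dotv_row_le => // i.
rewrite (hess_twice_diffE _ _ _ _ _ Om_open (C2_on_twice_diff _ _ (a_C0C2 i).2) Oy).
apply: le_trans (B0 i y Oy); rewrite ler_norml opnorm2_ge// andbT lerNl.
rewrite (_ : - _ = ((- u1) *m hess (a i) y *m v1^T) 0 0).
  by rewrite opnorm2_ge// norm2N.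
by rewrite !mulNmx [RHS]mxE.
Qed.

End Adjoint.

(** * Distance to a finite family of points *)

Section DistanceToPoints.
Context {R : realType} {d s : nat}.
Implicit Types (x : 'rV[R]_d) (xi : 'I_s -> 'rV[R]_d) (c : R).

Lemma dist_pt_le x xi i : dist_pt x xi <= norm2 (x - xi i).
Proof.
apply: ge_inf; last by exists i.
by exists 0 => _ [j _ <-]; exact: norm2_ge0.
Qed.

Lemma dist_pt_lt x xi c : (0 < s)%N -> dist_pt x xi < c ->
  exists i, norm2 (x - xi i) < c.
Proof.
move=> s0 xc; apply: contrapT => /forallNP no.
move: xc; apply/negP; rewrite -leNgt; apply: lb_le_inf.
  by exists (norm2 (x - xi (Ordinal s0))), (Ordinal s0).
by move=> _ [i _ <-]; rewrite leNgt; apply/negP; exact: no.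
Qed.

End DistanceToPoints.

(** * Points of [Xset]: existence, criticality and closeness to [xi] *)

Section LocalMaximizers.
Context {R : realType} {d m : nat} (Om : set 'rV[R]_d).
Context (a : 'I_m -> 'rV[R]_d -> R).
Implicit Types (p q : 'rV[R]_m) (x y u v : 'rV[R]_d).
Hypothesis Om_open : open Om.
Hypothesis Om_convex : convex_set Om.
Hypothesis a_C0C2 : forall i, C0_on Om (a i) /\ C2_on Om (a i).
Hypothesis a_bounded : exists B : R, forall i x, Om x ->
  norm2 (grad (a i) x) <= B /\ opnorm2 (hess (a i) x) <= B.

Lemma Xset_subset q y : Xset Om a q y -> Om y.
Proof. by case=> -[]. Qed.

Lemma Xset_critical q y v : Xset Om a q y -> 'D_v (Astar a q) y = 0.
Proof.
move=> [ymax y1]; apply: (@local_max_critical _ _ Om) ymax _ => //.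
  exact: twice_diff_Astar.
by rewrite -normr_gt0 (lt_trans _ y1).
Qed.

Lemma Xset_argmax q x : Om x -> 1 < `|Astar a q x| ->
  exists2 y, Xset Om a q y & forall z, Om z -> `|Astar a q z| <= `|Astar a q y|.
Proof.
move=> Ox x1.
have [y Oy ymax] := C0_on_max _ _ _ _ (C0_on_Astar _ _ a_C0C2 q) ltr01 Ox x1.
exists y => //; split; last exact: lt_le_trans x1 (ymax _ Ox).
by split => //; exists 1; split => // z Oz _; exact: ymax.
Qed.

(** The first-order term at [y] vanishes, so passing from [y] to [x] costs only a quadratic amount.
    This is the source of the linear rate. *)
Lemma abs_Astar_critical_le q x y : Om x -> Xset Om a q y ->
  `|Astar a q y| <= `|Astar a q x| + kappa_hess Om a * norm2 q * norm2 (x - y) ^+ 2.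
Proof.
move=> Ox Xy; have Oy := Xset_subset _ _ Xy.
have yx : y + (x - y) = x by rewrite addrC subrK.
have [|z Oz] := MVT_line2 Om (Astar a q) y (x - y) Om_open Om_convex
  (twice_diff_Astar _ _ Om_open a_C0C2 q) Oy.
  by rewrite yx.
rewrite yx Xset_critical// subr0 => h.
rewrite -lerBlDl (le_trans (lerB_dist _ _))// distrC (le_trans h)//.
exact: abs_derive2_Astar_le.
Qed.

Context {s : nat} (xi : 'I_s -> 'rV[R]_d) (qstar : 'rV[R]_m) (gamma tau0 : R).
Hypothesis s_gt0 : (0 < s)%N.
Hypothesis xi_Om : forall i, Om (xi i).
Hypothesis tau0_gt0 : 0 < tau0.
Hypothesis gamma_gt0 : 0 < gamma.
Hypothesis qstar_feasible : dual_feasible Om a qstar.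
Hypothesis qstar_xi : forall i, `|Astar a qstar (xi i)| = 1.
Hypothesis near_xi : forall x, Om x -> dist_pt x xi <= tau0 ->
  gamma * tau0 ^+ 2 / 2 <= `|Astar a qstar x| /\
  loewner_le_neg (hess (fun y => `|Astar a qstar y|) x) gamma.
Hypothesis far_xi : forall x, Om x -> tau0 <= dist_pt x xi ->
  `|Astar a qstar x| <= 1 - gamma * tau0 ^+ 2 / 2.

Let g (x : 'rV[R]_d) := `|Astar a qstar x|.

Let xi_critical i v : 'D_v (Astar a qstar) (xi i) = 0.
Proof.
apply: (@local_max_critical _ _ Om) => //.
- exact: twice_diff_Astar.
- split=> //; exists 1; split => // y Oy _; rewrite qstar_xi.
  exact: qstar_feasible.
- by rewrite -normr_gt0 qstar_xi.
Qed.

(* Strong concavity of |A^* qstar| along the segment from [xi i] to [y] bounds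
   its slope at [y] from below; criticality of [y] for [q] bounds it above. *)
Lemma Xset_near_xi q y (b : R) : Xset Om a q y ->
  (forall p x, Om x -> `|Astar a p x| <= b * norm2 p) ->
  b * norm2 (q - qstar) < gamma * tau0 ^+ 2 / 2 ->
  exists i, gamma * norm2 (y - xi i) <= kappa_grad Om a * norm2 (q - qstar).
Proof.
move=> Xy bA bq; have Oy := Xset_subset _ _ Xy.
have [i yi] : exists i, norm2 (y - xi i) < tau0.
  (* Far from [xi] the certificate [qstar] stays below 1 by a margin larger than the perturbation,
     so [Astar a q] could not exceed 1 at [y]. *)
  apply: dist_pt_lt => //; rewrite ltNge; apply/negP => /(far_xi _ Oy) hy.
  have := ler_normD (Astar a qstar y) (Astar a (q - qstar) y).
  rewrite AstarB addrC subrK -AstarB => h.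
  have := le_lt_trans (bA (q - qstar) y Oy) bq.
  have := Xy.2; lra.
exists i; set v := y - xi i.
have yE : xi i + v = y by rewrite addrC subrK.
have [->|v0] := eqVneq (norm2 v) 0.
  by rewrite mulr0 mulr_ge0 ?norm2_ge0 ?kappa_grad_ge0.
have U_open := open_neq0 _ _ Om_open (twice_diff_Astar _ _ Om_open a_C0C2 qstar).
have gU := twice_diff_norm _ _ Om_open (twice_diff_Astar _ _ Om_open a_C0C2 qstar).
(* The whole segment lies in [U]: it stays within [tau0] of [xi], where [near_xi] keeps the
   certificate away from 0. *)
set U := [set x | _] in U_open gU.
have tau_pos : 0 < gamma * tau0 ^+ 2 / 2 by rewrite !mulr_gt0// exprn_gt0.
have seg t : 0 <= t <= 1 -> Om (xi i + t *: v) /\ dist_pt (xi i + t *: v) xi <= tau0.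
  move=> t01; split; first by apply: convex_set_segment; rewrite ?yE.
  rewrite (le_trans (dist_pt_le _ _ i))// addrC addKr norm2Z.
  move: t01 => /andP[t0 t1]; rewrite ger0_norm//.
  by rewrite (le_trans _ (ltW yi))// ler_piMl ?norm2_ge0.
have segU t : 0 <= t <= 1 -> U (xi i + t *: v).
  move=> /seg[Ot dt]; split => //; rewrite -normr_gt0.
  by apply: lt_le_trans tau_pos _; case: (near_xi _ Ot dt).
have [t t01] : exists2 t : R, 0 <= t <= 1 &
    'D_v g (xi i + v) - 'D_v g (xi i) = 'D_v ('D_v g) (xi i + t *: v).
  apply: (MVT_line ('D_v g)) => t t01; apply: diff_derivable; apply: gU.2.
  exact: segU.
rewrite (hess_twice_diffE _ _ _ _ _ U_open gU (segU _ t01)) yE.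
have [Ot dt] := seg _ t01.
have [_ /(_ v) concave] := near_xi _ Ot dt => E.
rewrite -E in concave.
have h0 : 'D_v g (xi i) = 0.
  apply/eqP; rewrite -normr_eq0 (derive_norm _ _ _ _ Om_open)//.
  - by rewrite xi_critical normr0.
  - exact: twice_diff_Astar.
  - by rewrite -normr_gt0 qstar_xi.
have Uy : U y by rewrite -yE -[v]scale1r; apply: segU; rewrite ler01 lexx.
have hy : `|'D_v g y| <= kappa_grad Om a * norm2 (q - qstar) * norm2 v.
  rewrite (derive_norm _ _ _ _ Om_open (twice_diff_Astar _ _ Om_open a_C0C2 _) Oy Uy.2).
  (* By criticality of [y] for [q], only the contribution of [q - qstar] remains. *)
  rewrite (_ : 'D_v (Astar a qstar) y = - 'D_v (Astar a (q - qstar)) y).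
    by rewrite normrN; exact: abs_derive_Astar_le.
  rewrite !(derive_Astar Om a a_C0C2)// dotvDl dotvNl.
  by rewrite -(derive_Astar Om a a_C0C2 q)// Xset_critical// add0r opprK.
rewrite -(@ler_pM2r _ (norm2 v)); last by rewrite lt_def v0 norm2_ge0.
rewrite -mulrA -expr2 (le_trans _ hy)// -normrN (le_trans _ (ler_norm _))//.
by rewrite lerNr -mulNr; rewrite h0 subr0 in concave.
Qed.

End LocalMaximizers.

(** * Two nearby points among many points in few balls *)

Section Pigeonhole.
Context {R : realType} {d s : nat}.

Lemma truncn_eq_dist (x y : R) : 0 <= x -> 0 <= y ->
  Num.truncn x = Num.truncn y -> `|x - y| <= 1.
Proof.
move=> x0 y0 xy; have := truncn_itv x0; have := truncn_itv y0.
rewrite xy -natr1 => /andP[? ?] /andP[? ?]; rewrite ler_norml; apply/andP.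
split; lra.
Qed.

(* Cells: the index of a ball, and a cube of side [r / P] inside it. *)
Lemma pigeonhole_balls (P : nat) (r : R) (xi : 'I_s -> 'rV[R]_d)
    (y : nat -> 'rV[R]_d) :
  (0 < P)%N -> 0 < r ->
  (forall j, (j <= s * (2 * P).+1 ^ d)%N -> exists i, norm2 (y j - xi i) <= r) ->
  exists j l : nat, [/\ (j < l)%N, (l <= s * (2 * P).+1 ^ d)%N &
    norm2 (y j - y l) ^+ 2 <= d%:R * (r / P%:R) ^+ 2].
Proof.
set N := (s * _)%N => P0 r0 yr.
have /choice[I yI] : forall j : 'I_N.+1, exists i, norm2 (y j - xi i) <= r.
  by move=> j; apply: yr; rewrite -ltnS.
have PR : 0 < P%:R :> R by rewrite ltr0n.
(* Offsets from the centre, in [[- r, r]], are rescaled to [[0, 2 P]]; unit intervals then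
   correspond to length [r / P], and truncation has [2 P + 1] values. *)
pose pos (j : 'I_N.+1) (c : 'I_d) := P%:R + (y j - xi (I j)) 0 c * (P%:R / r).
have posP j c : 0 <= pos j c <= (2 * P)%:R.
  have : `|(y j - xi (I j)) 0 c * (P%:R / r)| <= P%:R.
    rewrite normrM [`|P%:R / r|]gtr0_norm ?divr_gt0// mulrCA ler_piMr ?ler0n//.
    by rewrite ler_pdivrMr// mul1r (le_trans (abs_coord_le_norm2 _ _)).
  rewrite ler_norml /pos natrM => /andP[? ?]; apply/andP; split; lra.
pose cell (j : 'I_N.+1) : 'I_s * {ffun 'I_d -> 'I_(2 * P).+1} :=
  (I j, [ffun c => inord (Num.truncn (pos j c))]).
have [/leq_card|] := pselect (injective cell).
  by rewrite card_prod card_ffun !card_ord -/N ltnn.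
move=> /existsNP[j /existsNP[l /not_implyP[cjl jl]]].
have jl_close : norm2 (y j - y l) ^+ 2 <= d%:R * (r / P%:R) ^+ 2.
  apply: norm2_le_coord => [|c]; first by rewrite divr_ge0 ?ltW.
  case: cjl => Ijl /ffunP/(_ c); rewrite !ffunE => /(congr1 (@nat_of_ord _)).
  have tr j' : (Num.truncn (pos j' c) < (2 * P).+1)%N.
    have /andP[p0 p1] := posP j' c; have /andP[+ _] := truncn_itv p0.
    by move=> /le_trans /(_ p1); rewrite ler_nat.
  rewrite !inordK// => /truncn_eq_dist.
  have /andP[+ _] := posP j c => -> //.
  have /andP[+ _] := posP l c => -> //.
  rewrite /pos Ijl => /(_ isT isT).
  rewrite opprD addrACA subrr add0r -mulrBl normrM.
  rewrite [`|P%:R / r|]gtr0_norm ?divr_gt0// -ler_pdivlMr ?divr_gt0//.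
  rewrite mul1r invf_div; congr (`|_| <= _); rewrite !mxE; ring.
have : (j : nat) != l by apply/eqP => /val_inj.
rewrite neq_ltn => /orP[lt_jl|lt_lj].
- by exists j, l; split => //; rewrite -ltnS.
- exists l, j; split => //; first by rewrite -ltnS.
  by rewrite -norm2N opprB.
Qed.

End Pigeonhole.

(** * Geometric decay of the gap *)

Section LinearRate.
Context {R : realType} {d s : nat}.
Variables (D : nat -> R) (y : nat -> 'rV[R]_d) (xi : 'I_s -> 'rV[R]_d).
Variables (A B : R) (P K : nat).
Hypothesis D_noninc : forall k, D k.+1 <= D k.
Hypothesis D_ge0 : forall k, 0 <= D k.
Hypothesis A_ge0 : 0 <= A.
Hypothesis B_gt0 : 0 < B.
Hypothesis P_gt0 : (0 < P)%N.
Hypothesis y_near : forall k, (K <= k)%N -> 0 < D k ->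
  exists i, norm2 (y k - xi i) <= B * Num.sqrt (D k).
Hypothesis D_cut : forall j l, (j < l)%N -> 0 < D l ->
  D l <= A * norm2 (y j - y l) ^+ 2.
Hypothesis P_large : A * d%:R * B ^+ 2 <= expR (- 2) * P%:R ^+ 2.

Lemma noninc_le j l : (j <= l)%N -> D l <= D j.
Proof.
move=> /subnK <-; elim: (l - j)%N => // n IH.
by rewrite addSn (le_trans (D_noninc _)).
Qed.

Let N := (s * (2 * P).+1 ^ d)%N.

(** By monotonicity the points [y k], ..., [y (k + N)] lie in the same [s] balls of radius
    [B * Num.sqrt (D k)], and they outnumber the cells by one. The factor [expR (- 2)] makes the
    square root of the gap shrink by [e], to match [ln] in [rate_tau]. *)
Lemma linear_contraction k : (K <= k)%N -> D (k + N) <= expR (- 2) * D k.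
Proof.
(* If the last gap is positive, so are all earlier ones, and every [y] of the window is
   meaningful. *)
move=> Kk; have := D_ge0 (k + N); rewrite le_eqVlt => /orP[/eqP <-|DN].
  by rewrite mulr_ge0// expR_ge0.
have Dpos j : (j <= k + N)%N -> 0 < D j by move=> /noninc_le; exact: lt_le_trans.
have Dk : 0 < D k by apply: Dpos; rewrite leq_addr.
have r0 : 0 < B * Num.sqrt (D k) by rewrite mulr_gt0// sqrtr_gt0.
have y_in j : (j <= N)%N ->
    exists i, norm2 (y (k + j)%N - xi i) <= B * Num.sqrt (D k).
  move=> jN; have [||i yi] := y_near (k + j).
  - exact: leq_trans Kk (leq_addr _ _).
  - by apply: Dpos; rewrite leq_add2l.
  exists i; rewrite (le_trans yi)// ler_wpM2l ?(ltW B_gt0)// ler_wsqrtr//.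
  by apply: noninc_le; rewrite leq_addr.
have [j [l [jl lN]]] := pigeonhole_balls P _ xi _ P_gt0 r0 y_in.
rewrite !exprMn (sqr_sqrtr (D_ge0 k)) => yjl.
apply: (@le_trans _ _ (D (k + l))).
  by apply: noninc_le; rewrite leq_add2l.
apply: (@le_trans _ _ (A * norm2 (y (k + j) - y (k + l)) ^+ 2)).
  by apply: D_cut; [rewrite ltn_add2l|apply: Dpos; rewrite leq_add2l].
rewrite (le_trans (ler_wpM2l A_ge0 yjl))// exprVn.
have P2 : 0 < P%:R ^+ 2 :> R by rewrite exprn_gt0// ltr0n.
rewrite !mulrA ler_pdivrMr// [leRHS]mulrAC.
by rewrite -[A * _ * B * B]mulrA ler_wpM2r.
Qed.

Lemma geometric_decay j : D (K + N * j) <= expR (- 2) ^+ j * D K.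
Proof.
elim: j => [|j IH]; first by rewrite muln0 addn0 expr0 mul1r.
rewrite mulnS addnCA addnC (le_trans (linear_contraction _ _)) ?leq_addr//.
by rewrite exprS -mulrA ler_wpM2l// expR_ge0.
Qed.

Lemma rate_tau (tau : R) (k : nat) : 0 < tau <= 1 ->
  K%:R + N%:R * (Num.ceil (ln (1 / tau)))%:~R <= k%:R :> R ->
  D k <= tau ^+ 2 * D K.
Proof.
move=> /andP[tau0 tau1].
have ln0 : 0 <= ln (1 / tau) by rewrite ln_ge0// div1r invf_ge1.
have : (0 <= Num.ceil (ln (1 / tau)))%R by rewrite ceil_ge0 (lt_le_trans _ ln0) ?ltrN10.
have := ceil_ge (ln (1 / tau)).
(* The ceiling is nonnegative, hence a natural number of periods [j], and the bound on [k] becomes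
   one between naturals. *)
case: (Num.ceil _) => // j lnj _.
rewrite -pmulrn -natrM -natrD ler_nat => kj.
apply: le_trans (noninc_le _ _ kj) _.
apply: le_trans (geometric_decay j) _; rewrite ler_wpM2r//.
have -> : expR (- 2) ^+ j = expR (- j%:R) ^+ 2 :> R.
  by rewrite -!expRM_natr; congr expR; ring.
have jtau : expR (- j%:R) <= tau.
  rewrite -[leRHS]lnK ?posrE// ler_expR lerNl -lnV ?posrE// -div1r.
  by rewrite (le_trans lnj).
by rewrite ler_pXn2r// nnegrE ?expR_ge0// ltW.
Qed.

End LinearRate.
(** If [D] stayed above [eps], each step would lower it by at least the fixed amount
    [eps ^+ 2 / (c + 1)], and it would become negative. *)
Lemma quadratic_decrease_small (R : realType) (D : nat -> R) (c eps : R) :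
  0 <= c -> (forall k, 0 <= D k) -> (forall k, D k ^+ 2 <= c * (D k - D k.+1)) ->
  0 < eps -> exists k, D k < eps.
Proof.
move=> c0 D0 Dc e0; apply: contrapT => /forallNP no.
have eD k : eps <= D k by rewrite leNgt; apply/negP; exact: no.
have c1 : 0 < c + 1 by rewrite ltr_wpDl.
pose del := eps ^+ 2 / (c + 1).
have del0 : 0 < del by rewrite divr_gt0// exprn_gt0.
have step k : del <= D k - D k.+1.
  have e2 : eps ^+ 2 <= c * (D k - D k.+1).
    by rewrite (le_trans _ (Dc k))// ler_pXn2r// ?nnegrE ?(ltW e0)// D0.
  have c_pos : 0 < c * (D k - D k.+1) by rewrite (lt_le_trans _ e2)// exprn_gt0.
  have Dpos : 0 < D k - D k.+1.
    by rewrite ltNge; apply/negP => /(mulr_ge0_le0 c0); rewrite leNgt c_pos.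
  rewrite ler_pdivrMr//; lra.
have Dn n : D n <= D 0%N - n%:R * del.
  elim: n => [|n IH]; first by rewrite mul0r subr0.
  have := step n; rewrite -natr1; lra.
have := Dn (Num.truncn (D 0%N / del)).+1.
have /andP[_] := truncn_itv (divr_ge0 (D0 0%N) (ltW del0)).
rewrite ltr_pdivrMr// => h.
have := D0 (Num.truncn (D 0%N / del)).+1; lra.
Qed.

(** * Primal and dual values, and bounds on dual solutions *)

Section Problems.
Context {R : realType} {d m : nat} (Om : set 'rV[R]_d).
Context (a : 'I_m -> 'rV[R]_d -> R) (f : 'rV[R]_m -> R).
Implicit Types (q : 'rV[R]_m) (nu : smeasure R d).

Lemma infP_solvesP Om' nu : solvesP Om Om' a f nu ->
  infP Om Om' a f = Jobj Om a f nu.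
Proof.
move=> [nuM numin]; apply/eqP; rewrite eq_le; apply/andP; split.
  apply: ge_inf; last by exists nu.
  by exists (Jobj Om a f nu) => _ [nu' nu'M <-]; exact: numin.
apply: lb_le_inf; first by exists (Jobj Om a f nu), nu.
by move=> _ [nu' nu'M <-]; exact: numin.
Qed.

Lemma supD_solvesD Om' q : solvesD Om' a f q -> supD Om' a f = (- fstar f q)%E.
Proof.
move=> [qf qmax]; apply/eqP; rewrite eq_le; apply/andP; split.
  by apply: ge_ereal_sup => _ [q' q'f <-]; exact: qmax.
by apply: ereal_sup_ubound; exists q.
Qed.

Lemma dual_feasible_midpoint Om' p q :
  dual_feasible Om' a p -> dual_feasible Om' a q ->
  dual_feasible Om' a (2^-1 *: (p + q)).
Proof.
move=> pf qf x Ox; rewrite AstarE_dotv dotvZl dotvDl -!AstarE_dotv.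
have := pf x Ox; have := qf x Ox; rewrite !ler_norml.
move=> /andP[? ?] /andP[? ?]; apply/andP; split; lra.
Qed.

Lemma dual_feasible0 Om' : dual_feasible Om' a 0.
Proof.
by move=> x _; rewrite AstarE_dotv -(scale0r 0) dotvZl mul0r normr0.
Qed.

Lemma dual_feasible_subset Om1 Om2 q : Om1 `<=` Om2 ->
  dual_feasible Om2 a q -> dual_feasible Om1 a q.
Proof. by move=> s12 qf x /s12; exact: qf. Qed.

Variables (L : R).
Hypothesis f_diff : forall z, differentiable f z.
Hypothesis L_gt0 : 0 < L.
Hypothesis grad_lip :
  forall z w, norm2 (grad f z - grad f w) <= L * norm2 (z - w).

Lemma solvesD_quadratic_growth Om' p q (u v : R) :
  solvesD Om' a f p -> dual_feasible Om' a q ->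
  fstar f p = u%:E -> fstar f q = v%:E ->
  norm2 (q - p) ^+ 2 <= 8 * L * (v - u).
Proof.
move=> [pf pmax] qf; apply: (fstar_quadratic_growth f L f_diff L_gt0 grad_lip
  (dual_feasible Om' a)).
  exact: dual_feasible_midpoint.
by move=> q' /pmax; rewrite leeN2.
Qed.

(** Since 0 is feasible, [fstar f q] is at most [fstar f 0]. Growth around [qbar] has constant
    [8 * L] where [Rconst] has [2 * L]; hence the factor 2. *)
Lemma solvesD_norm_le Om' q qbar (b : R) : (forall z, b <= f z) ->
  (forall q, (fstar f qbar <= fstar f q)%E) ->
  solvesD Om' a f q -> norm2 q <= 2 * Rconst f L qbar.
Proof.
move=> fb qbar_min [qf qmax].
have f0 : fstar f 0 \is a fin_num by exact: fstar_fin_num _ _ _ (fstar0_le _ _ fb).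
have q0 : (fstar f q <= fstar f 0)%E.
  by have := qmax _ (dual_feasible0 Om'); rewrite leeN2.
have fq : fstar f q \is a fin_num.
  by apply: (@fstar_fin_num _ _ f q (fine (fstar f 0))); rewrite fineK.
have fbar : fstar f qbar \is a fin_num.
  by apply: (@fstar_fin_num _ _ f qbar (fine (fstar f 0))); rewrite fineK.
have := @fstar_quadratic_growth _ _ f L f_diff L_gt0 grad_lip setT qbar q
  (fine (fstar f qbar)) (fine (fstar f q)) I (fun q' _ => qbar_min q')
  (esym (fineK fbar)) (esym (fineK fq)).
have : fine (fstar f q) <= fine (fstar f 0) by rewrite fine_le.
rewrite /Rconst; set F0 := fine (fstar f 0); set Fb := fine (fstar f qbar).
move=> hq h8.
have {}h8 : norm2 (q - qbar) <= 2 * Num.sqrt (2 * L * (F0 - Fb)).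
  have F0b : 0 <= F0 - Fb by rewrite subr_ge0 fine_le.
  rewrite -(@ler_pXn2r _ 2)// ?nnegrE ?norm2_ge0 ?mulr_ge0 ?sqrtr_ge0//.
  have x0 : 0 <= 2 * L * (F0 - Fb) by rewrite !mulr_ge0// ltW.
  rewrite exprMn (sqr_sqrtr x0) (le_trans h8)//.
  move: hq; rewrite -(ler_pM2l L_gt0); lra.
have := norm2D (q - qbar) qbar; rewrite subrK.
have := norm2_ge0 qbar; lra.
Qed.

End Problems.

(** * Duality estimates for the atomic primal solution *)

Section AtomicSolution.
Context {R : realType} {d m s : nat} (Om : set 'rV[R]_d).
Context (a : 'I_m -> 'rV[R]_d -> R) (f : 'rV[R]_m -> R).
Variables (mustar : smeasure R d) (xi : 'I_s -> 'rV[R]_d) (alpha : 'I_s -> R).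
Hypothesis Om_open : open Om.
Hypothesis a_cont : forall i x, Om x -> {for x, continuous (a i)}.
Hypothesis mustarE : forall A : set (borelV R d), measurable A ->
  mustar A = (\sum_(i < s | (xi i : borelV R d) \in A) alpha i)%:E.
Hypothesis xi_inj : injective xi.
Hypothesis xi_Om : forall i, Om (xi i).

Let T := \sum_i `|alpha i|.
Let w := Aop Om a mustar.

(** Adjointness of [Aop] and [Astar], for the atomic measure. *)
Lemma dotv_Aop_atomic q : dotv q w = \sum_i alpha i * Astar a q (xi i).
Proof.
rewrite /dotv; under eq_bigr => i _.
  rewrite mxE (sint_atomic _ _ _ mustarE xi_inj _ _ Om_open xi_Om); last first.
    by apply: borelV_measurable_fun => //; exact: a_cont.
  rewrite mulr_sumr; over.
rewrite exchange_big; apply: eq_bigr => j _; rewrite mulr_sumr.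
by apply: eq_bigr => i _; rewrite mulrCA.
Qed.

Lemma Jobj_atomic : Jobj Om a f mustar = T + f w.
Proof. by rewrite /Jobj (tvnorm_atomic _ _ _ mustarE xi_inj). Qed.

(** Fenchel-Young at [w]: pairing [q] with an atomic measure of mass [T] costs at most
    [T * (1 + e)], of which [T] is already in the primal value. *)
Lemma atomic_dual_gap q (u e : R) : fstar f q = (- u)%:E ->
  (forall i, `|Astar a q (xi i)| <= 1 + e) ->
  u - (T + f w) <= T * e.
Proof.
move=> qu qe; have := fenchel_young f q w; rewrite qu lee_fin dotv_Aop_atomic.
have : - \sum_i alpha i * Astar a q (xi i) <= T * (1 + e).
  rewrite -sumrN mulr_suml ler_sum// => i _.
  by rewrite (le_trans (ler_norm _))// normrN normrM ler_wpM2l.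
rewrite mulrDr; lra.
Qed.

(* [Aop mustar] is a subgradient of [f^*] at [qstar], and
   [- <Aop mustar, qstar>] is the total mass. *)
Lemma total_mass_le_rho2 qstar (L : R) : 0 < L ->
  rho2 f L qstar \is a fin_num ->
  fstar f qstar = (- (T + f w))%:E -> dual_feasible Om a qstar ->
  L * T <= rhoconst f L qstar ^+ 2.
Proof.
move=> L0 rfin qE qf.
have h1 := fenchel_young f qstar w; rewrite qE lee_fin in h1.
have h2 : - T <= dotv qstar w.
  rewrite dotv_Aop_atomic -sumrN ler_sum// => i _; rewrite lerNl.
  rewrite (le_trans (ler_norm _))// normrN normrM ler_piMr//.
  exact: qf.
have : ((- L * dotv w qstar)%:E <= rho2 f L qstar)%E.
  apply: ereal_sup_ubound; exists w => // q.
  rewrite qE -EFinD (le_trans _ (fenchel_young f q w))// lee_fin.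
  rewrite dotvDr dotvNr !(dotvC w); lra.
rewrite -{1}(fineK rfin) lee_fin => h3.
have LT : L * T <= fine (rho2 f L qstar).
  by rewrite (le_trans _ h3)// dotvC; nra.
rewrite /rhoconst sqr_sqrtr// (le_trans _ LT)// mulr_ge0 ?(ltW L0)//.
by apply: sumr_ge0.
Qed.

End AtomicSolution.

(** * Explicit constants, and monotonicity of the exchange sets *)

(** A bound on the total mass of the solution, times the Hessian bound for a dual iterate of norm at
    most [2 * Rc]. *)
Definition cut_const {R : realType} (khess rho Rc L : R) : R :=
  rho ^+ 2 / L * (khess * (2 * Rc)).

(** Radius of the balls around [xi], relative to the square root of the gap; the added 1 keeps it
    positive. *)
Definition loc_const {R : realType} (gamma kgrad L : R) : R :=
  (kgrad + 1) / gamma * Num.sqrt (8 * L).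

Definition grid_size {R : realType} (x : R) : nat :=
  (Num.truncn (expR 2 * x)).+1.

Definition rate_period {R : realType} (d s : nat)
    (gamma kgrad khess rho Rc L : R) : nat :=
  (s * (2 * grid_size (cut_const khess rho Rc L * d%:R *
                       loc_const gamma kgrad L ^+ 2)).+1 ^ d)%N.

(** The grid size is at least 1 and at least [expR 2 * x], hence so is its square. *)
Lemma grid_size_large (R : realType) (x : R) : 0 <= x ->
  x <= expR (- 2) * (grid_size x)%:R ^+ 2.
Proof.
move=> x0; rewrite -(@ler_pM2l _ (expR 2)) ?expR_gt0//.
rewrite mulrA -expRD subrr expR0 mul1r.
have /andP[_ /ltW h] := truncn_itv (mulr_ge0 (expR_ge0 (2 : R)) x0).
by rewrite (le_trans h)// expr2 ler_peMr ?ler0n ?ler1n.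
Qed.

Lemma exchange_run_subset (R : realType) (d m : nat) (Om Om0 : set 'rV[R]_d)
    (a : 'I_m -> 'rV[R]_d -> R) (f : 'rV[R]_m -> R) Oms mus qs :
  Om0 `<=` Om -> exchange_run Om a f Om0 Oms mus qs -> forall k, Oms k `<=` Om.
Proof.
move=> O0 [E0 run]; elim=> [|k IH]; first by rewrite E0.
have [_ _ ->] := run k; rewrite subUset; split => //.
by move=> x; exact: Xset_subset.
Qed.

Lemma exchange_run_mono (R : realType) (d m : nat) (Om Om0 : set 'rV[R]_d)
    (a : 'I_m -> 'rV[R]_d -> R) (f : 'rV[R]_m -> R) Oms mus qs :
  exchange_run Om a f Om0 Oms mus qs ->
  forall j k, (j <= k)%N -> Oms j `<=` Oms k.
Proof.
move=> [_ run] j k /subnK <-; elim: (k - j)%N => // n IH.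
by rewrite addSn; have [_ _ ->] := run (n + j)%N; apply: subset_trans IH _; left.
Qed.

(** * Linear convergence of the exchange iterates *)

Theorem mainTheorem11 (R : realType) (d : nat) :
  (* the constants (taubar0, C, C') as a function of
     (s, gamma, tau0, kappa, kappa_grad, kappa_hess, rho, Rconst, L) only *)
  exists F : nat -> R -> R -> R -> R -> R -> R -> R -> R -> R * R * R,
  forall (m s : nat) (Om : set 'rV[R]_d) (a : 'I_m -> 'rV[R]_d -> R)
    (f : 'rV[R]_m -> R) (L : R)
    (mustar : smeasure R d) (xi : 'I_s -> 'rV[R]_d) (alpha : 'I_s -> R)
    (qstar qbar : 'rV[R]_m) (gamma tau0 : R)
    (Om0 : set 'rV[R]_d) (Oms : nat -> set 'rV[R]_d)
    (mus : nat -> smeasure R d) (qs : nat -> 'rV[R]_m),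
  (* Omega: nonempty open convex *)
  Om !=set0 -> open Om -> convex_set Om ->
  (* the measurement functions a_i *)
  (forall i, C0_on Om (a i) /\ C2_on Om (a i)) ->
  (exists B : R, forall i x, Om x ->
     norm2 (grad (a i) x) <= B /\ opnorm2 (hess (a i) x) <= B) ->
  (* the data-fidelity f *)
  (forall (x y : 'rV[R]_m) (t : R), 0 <= t <= 1 ->
     f ((1 - t) *: x + t *: y) <= (1 - t) * f x + t * f y) ->
  (exists b : R, forall z, b <= f z) ->
  (forall z, differentiable f z) ->
  0 < L ->
  (forall z w, norm2 (grad f z - grad f w) <= L * norm2 (z - w)) ->
  (* qbar minimizes f^*; rho is finite *)
  (forall q, (fstar f qbar <= fstar f q)%E) ->
  rho2 f L qstar \is a fin_num ->
  (* standing assumptions on (P) and (D) *)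
  (infP Om Om a f)%:E = supD Om a f ->
  (* source condition *)
  (0 < s)%N ->
  solvesP Om Om a f mustar ->
  (forall nu, solvesP Om Om a f nu ->
     forall A : set (borelV R d), measurable A -> nu A = mustar A) ->
  (forall A : set (borelV R d), measurable A ->
     mustar A = (\sum_(i < s | (xi i : borelV R d) \in A) alpha i)%:E) ->
  injective xi -> (forall i, Om (xi i)) -> (forall i, alpha i != 0) ->
  solvesD Om a f qstar ->
  (forall x, Om x -> (`|Astar a qstar x| = 1 <-> exists i, x = xi i)) ->
  0 < tau0 -> 0 < gamma ->
  (forall x, Om x -> dist_pt x xi <= tau0 ->
     gamma * tau0 ^+ 2 / 2 <= `|Astar a qstar x| /\
     loewner_le_neg (hess (fun y => `|Astar a qstar y|) x) gamma) ->
  (forall x, Om x -> tau0 <= dist_pt x xi ->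
     `|Astar a qstar x| <= 1 - gamma * tau0 ^+ 2 / 2) ->
  (* the exchange algorithm, with its standing assumptions *)
  Om0 `<=` Om ->
  exchange_run Om a f Om0 Oms mus qs ->
  (forall k, (infP Om (Oms k) a f)%:E = supD (Oms k) a f) ->
  let cst := F s gamma tau0 (kappa0 Om a) (kappa_grad Om a) (kappa_hess Om a)
               (rhoconst f L qstar) (Rconst f L qbar) L in
  let taubar0 := cst.1.1 in
  let C := cst.1.2 in
  let C' := cst.2 in
  [/\ 0 < taubar0, 0 < C, 0 < C' &
  exists k0 : nat, forall tau : R, 0 < tau <= taubar0 ->
    let ktau := C * (Num.ceil (ln (taubar0 / tau)))%:~R in
    (forall k : nat, k0%:R + ktau <= k%:R ->
       (dist_set xi (Xset Om a (qs k)) <= tau%:E)%E) /\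
    (forall k : nat, k0%:R + ktau + 1 <= k%:R ->
       norm2 (qs k - qstar) <= C' * tau /\
       infP Om (Oms k) a f <= infP Om Om a f + C' * tau ^+ 2)].
Proof.
exists (fun s gamma _ _ kg kh rho Rc L =>
  (1, (rate_period d s gamma kg kh rho Rc L)%:R, 1)).
move=> m s Om a f L mustar xi alpha qstar qbar gamma tau0 Om0 Oms mus qs.
move=> Om_ne Om_open Om_convex a_reg a_bd f_conv [fb fbP] f_diff L0 f_lip.
move=> qbar_min rho_fin gap s0 mu_sol _ muE xi_inj xi_Om _ qs_sol qs_xi.
move=> tau0_0 gamma0 near far Om0s run gaps cst taubar0 C C'.
have OmsO := exchange_run_subset _ _ _ _ _ _ _ _ _ _ Om0s run.
have Oms_mono := exchange_run_mono _ _ _ _ _ _ _ _ _ _ run.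
have {}run k : [/\ solvesP Om (Oms k) a f (mus k), solvesD (Oms k) a f (qs k)
    & Oms k.+1 = Oms k `|` Xset Om a (qs k)] by case: run.
have solk k : solvesD (Oms k) a f (qs k) by case: (run k).
have a_cont i x : Om x -> {for x, continuous (a i)}.
  by case: (a_reg i) => -[+ _] _; exact.
pose inf_star := infP Om Om a f; pose inf_k k := infP Om (Oms k) a f.
(* The absence of a duality gap makes the conjugate values real: they are opposite to primal
   infima. *)
have fstarS : fstar f qstar = (- inf_star)%:E.
  apply: oppe_inj; rewrite -(supD_solvesD _ _ _ _ qs_sol) -gap.
  by rewrite -EFinN opprK.
have fstarK k : fstar f (qs k) = (- inf_k k)%:E.
  apply: oppe_inj; rewrite -(supD_solvesD _ _ _ _ (solk k)) -gaps.
  by rewrite -EFinN opprK.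
pose D k := inf_k k - inf_star.
have qstar_feas k : dual_feasible (Oms k) a qstar.
  by apply: dual_feasible_subset (OmsO k) _; case: qs_sol.
have qk_feas j k : (j <= k)%N -> dual_feasible (Oms j) a (qs k).
  by move=> /Oms_mono jk; apply: dual_feasible_subset jk _; case: (solk k).
have D_ge0 k : 0 <= D k.
  have [_ /(_ _ (qstar_feas k))] := solk k.
  by rewrite fstarS fstarK lee_fin !opprK subr_ge0.
(* The next dual solution is feasible for the current, smaller constraint set. *)
have D_noninc k : D k.+1 <= D k.
  have [_ /(_ _ (qk_feas k k.+1 (leqnSn k)))] := solk k.
  by rewrite !fstarK lee_fin !opprK lerD2r.
have growth_star k : norm2 (qs k - qstar) ^+ 2 <= 8 * L * D k.
  rewrite -norm2N opprB.
  have := solvesD_quadratic_growth a f L f_diff L0 f_lip (Oms k) (qs k) qstar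
    _ _ (solk k) (qstar_feas k) (fstarK k) fstarS.
  by congr (_ <= _ * _); rewrite /D; ring.
have growth_step k : norm2 (qs k.+1 - qs k) ^+ 2 <= 8 * L * (D k - D k.+1).
  have := solvesD_quadratic_growth a f L f_diff L0 f_lip (Oms k) (qs k) (qs k.+1)
    _ _ (solk k) (qk_feas k k.+1 (leqnSn k)) (fstarK k) (fstarK k.+1).
  by congr (_ <= _ * _); rewrite /D; ring.
pose Rc := Rconst f L qbar.
have qk_le k : norm2 (qs k) <= 2 * Rc.
  exact: (solvesD_norm_le a f L f_diff L0 f_lip (Oms k) _ _ _ fbP qbar_min).
pose T := \sum_i `|alpha i|.
have T0 : 0 <= T by exact: sumr_ge0.
have inf_starE : inf_star = T + f (Aop Om a mustar).
  rewrite /inf_star (infP_solvesP _ _ _ _ _ mu_sol).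
  exact: (Jobj_atomic _ _ _ _ xi alpha).
have gapT k e : (forall i, `|Astar a (qs k) (xi i)| <= 1 + e) -> D k <= T * e.
  move=> He; have := atomic_dual_gap Om a f mustar xi alpha Om_open a_cont muE
    xi_inj xi_Om (qs k) (inf_k k) e (fstarK k) He.
  by rewrite -/T -inf_starE.
pose rho := rhoconst f L qstar.
have T_rho : T <= rho ^+ 2 / L.
  rewrite ler_pdivlMr// mulrC.
  apply: (total_mass_le_rho2 Om a f mustar xi alpha Om_open a_cont muE xi_inj
    xi_Om) => //; last by case: qs_sol.
  by rewrite -/T -inf_starE.
(* [y k] is a junk value when the gap is 0, so every fact about it is guarded by [0 < D k]. *)
have /choice[y yP] : forall k, exists y, 0 < D k -> Xset Om a (qs k) y /\
    D k <= T * (`|Astar a (qs k) y| - 1).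
  move=> k; have [Dk|Dk] := ltP 0 (D k); last by exists 0.
  (* Otherwise [gapT] with [e = 0] would give a zero gap. *)
  have [i xi1] : exists i, 1 < `|Astar a (qs k) (xi i)|.
    apply: contrapT => /forallNP no; move: Dk; rewrite ltNge => /negP; apply.
    rewrite -(mulr0 T); apply: gapT => i; rewrite addr0 leNgt.
    by apply/negP; exact: no.
  have [y Xy ymax] := Xset_argmax Om a a_reg (qs k) (xi i) (xi_Om i) xi1.
  exists y => _; split => //; apply: gapT => j.
  by rewrite addrC subrK; exact: ymax.
have y_feas j l : (j < l)%N -> 0 < D j -> `|Astar a (qs l) (y j)| <= 1.
  move=> jl /yP[Xy _]; have [/(_ (y j)) + _] := solk l; apply.
  by apply: (Oms_mono _ _ jl); have [_ _ ->] := run j; right.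
pose A := cut_const (kappa_hess Om a) rho Rc L.
pose B := loc_const gamma (kappa_grad Om a) L.
have Rc0 : 0 <= Rc by rewrite addr_ge0 ?sqrtr_ge0 ?norm2_ge0.
have kg0 := kappa_grad_ge0 Om a; have kh0 := kappa_hess_ge0 Om a.
have A0 : 0 <= A.
  apply: mulr_ge0; first by rewrite divr_ge0 ?sqr_ge0 ?(ltW L0).
  by rewrite mulr_ge0// mulr_ge0.
have L8 : 0 <= 8 * L by rewrite mulr_ge0// ltW.
have sqrtL0 : 0 < Num.sqrt (8 * L) by rewrite sqrtr_gt0 mulr_gt0.
have B0 : 0 < B by rewrite /B /loc_const mulr_gt0// divr_gt0// ltr_wpDl.
have noninc := noninc_le D D_noninc.
have D_cut j l : (j < l)%N -> 0 < D l -> D l <= A * norm2 (y j - y l) ^+ 2.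
  move=> jl Dl; have Dj : 0 < D j by rewrite (lt_le_trans Dl)// noninc// ltnW.
  have [Xl Dl_le] := yP l Dl; have Oj := Xset_subset _ _ _ _ (yP j Dj).1.
  have := abs_Astar_critical_le Om a Om_open Om_convex a_reg a_bd (qs l) _ _ Oj Xl.
  set n2 := norm2 (y j - y l) ^+ 2 => crit.
  have n20 : 0 <= n2 by exact: sqr_ge0.
  have {}crit : `|Astar a (qs l) (y l)| - 1 <= kappa_hess Om a * (2 * Rc) * n2.
    have := y_feas j l jl Dj.
    have := ler_wpM2r n20 (ler_wpM2l kh0 (qk_le l)); lra.
  rewrite (le_trans Dl_le)// (le_trans (ler_wpM2l T0 crit))//.
  rewrite /A /cut_const [leLHS]mulrA; apply: ler_wpM2r => //.
  by apply: ler_wpM2r T_rho; rewrite mulr_ge0// mulr_ge0.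
have [b b0 Ab] := Astar_bounded Om a a_reg.
have growth_sqrt k : norm2 (qs k - qstar) <= Num.sqrt (8 * L) * Num.sqrt (D k).
  rewrite -(@ler_pXn2r _ 2)// ?nnegrE ?norm2_ge0 ?mulr_ge0 ?sqrtr_ge0//.
  by rewrite exprMn (sqr_sqrtr (D_ge0 k)) (sqr_sqrtr L8).
pose G := gamma * tau0 ^+ 2 / 2.
have G0 : 0 < G by rewrite /G !mulr_gt0// exprn_gt0.
pose bL := (b * Num.sqrt (8 * L) / G) ^+ 2.
have bL0 : 0 <= bL by exact: sqr_ge0.
(* Collects what [D K] must absorb: 1 for the objective, [8 * L] for the dual error, [B ^+ 2] for
   the distance to [xi], and [bL] for entering the range of [Xset_near_xi]. *)
pose c := 1 + 8 * L + B ^+ 2 + bL.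
have B20 : 0 <= B ^+ 2 by exact: sqr_ge0.
have c0 : 0 < c by rewrite /c; lra.
have [K DK] : exists K, D K < c^-1.
  apply: (quadratic_decrease_small _ D (T ^+ 2 * b ^+ 2 * (8 * L))) => //.
  - by rewrite mulr_ge0// mulr_ge0 ?sqr_ge0.
  - move=> k; have := D_ge0 k; rewrite le_eqVlt => /orP[/eqP Dk0|Dk].
      rewrite -{1}Dk0 expr0n; apply: mulr_ge0; last by rewrite subr_ge0.
      by rewrite mulr_ge0// mulr_ge0 ?sqr_ge0.
    have [Xk Dk_le] := yP k Dk; have Ok := Xset_subset _ _ _ _ Xk.
    (* At [y k] the next iterate is at most 1 in modulus, so the excess over 1 is paid by the change
       from [qs k] to [qs k.+1]. *)
    have step : D k <= T * (b * norm2 (qs k.+1 - qs k)).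
      rewrite (le_trans Dk_le)// ler_wpM2l//.
      rewrite (le_trans _ (Ab _ _ Ok))// AstarB distrC.
      rewrite (le_trans _ (lerB_dist _ _))// lerB//.
      exact: y_feas.
    have := ler_pM (D_ge0 k) (D_ge0 k) step step.
    rewrite -!expr2 => /le_trans; apply; rewrite !exprMn mulrA.
    by rewrite -[leRHS]mulrA ler_wpM2l// mulr_ge0// sqr_ge0.
  - by rewrite invr_gt0.
have {}DK : D K * c < 1 by rewrite -ltr_pdivlMr// div1r.
have DKpart x : 0 <= x -> x <= c -> x * D K <= 1.
  move=> x0 xc; rewrite mulrC (le_trans _ (ltW DK))// ler_wpM2l//.
(* Stated for all of [Xset]: the contraction uses it at [y k], the distance claim at every point. *)
have near_y k x : (K <= k)%N -> Xset Om a (qs k) x ->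
    exists i, norm2 (x - xi i) <= B * Num.sqrt (D k).
  move=> Kk Xx.
  have small : b * norm2 (qs k - qstar) < G.
    rewrite (le_lt_trans (ler_wpM2l (ltW b0) (growth_sqrt k)))//.
    rewrite mulrA -[ltRHS]mul1r -ltr_pdivrMr// mulrAC.
    have q0 : 0 <= b * Num.sqrt (8 * L) / G * Num.sqrt (D k).
      by rewrite !mulr_ge0 ?invr_ge0 ?sqrtr_ge0 ?(ltW b0) ?(ltW G0).
    rewrite -(@ltr_pXn2r _ 2)// ?nnegrE// expr1n exprMn (sqr_sqrtr (D_ge0 k)).
    rewrite -/bL mulrC (le_lt_trans _ DK)//.
    apply: (@le_trans _ _ (D K * bL)); first by rewrite ler_wpM2r// noninc.
    by rewrite ler_wpM2l// /c; lra.
  have [||i hi] := Xset_near_xi Om a Om_open Om_convex a_reg a_bd xi qstar gamma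
    tau0 s0 xi_Om tau0_0 gamma0 (proj1 qs_sol) _ near far (qs k) x b Xx _ small.
  - by move=> i; apply/(qs_xi _ (xi_Om i)); exists i.
  - by move=> p z Oz; exact: Ab.
  exists i; rewrite -(ler_pM2l gamma0) (le_trans hi)//.
  have -> : gamma * (B * Num.sqrt (D k)) =
      (kappa_grad Om a + 1) * (Num.sqrt (8 * L) * Num.sqrt (D k)).
    by rewrite /B /loc_const; field; rewrite gt_eqF.
  by apply: ler_pM; rewrite ?norm2_ge0 ?lerDl ?ler01 ?growth_sqrt.
pose P := grid_size (A * d%:R * B ^+ 2).
have P_large : A * d%:R * B ^+ 2 <= expR (- 2) * P%:R ^+ 2.
  by apply: grid_size_large; rewrite mulr_ge0// mulr_ge0.
have rate := rate_tau D y xi A B P K D_noninc D_ge0 A0 B0 isT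
  (fun k Kk Dk => near_y k (y k) Kk (proj1 (yP k Dk))) D_cut P_large.
have N_ge1 : (0 < rate_period d s gamma (kappa_grad Om a) (kappa_hess Om a)
    rho Rc L)%N by rewrite muln_gt0 s0 expn_gt0.
split; rewrite ?ltr01 ?ltr0n//; exists K => tau /andP[tau_0 tau_1] ktau.
have ktau0 : 0 <= ktau.
  rewrite mulr_ge0 ?ler0n// ler0z ceil_ge0.
  by rewrite (@lt_le_trans _ _ 0) ?ltrN10// ln_ge0// div1r invf_ge1.
have Dtau k : K%:R + ktau <= k%:R -> D k <= tau ^+ 2 * D K.
  by move=> hk; apply: rate => //; rewrite tau_0 tau_1.
(* The choice of [K] gives [x ^+ 2 * D K <= 1], which is why no constant remains in front of
   [tau]. *)
have sqrtD x k : 0 <= x -> x ^+ 2 <= c -> K%:R + ktau <= k%:R ->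
    x * Num.sqrt (D k) <= tau.
  move=> x0 xc /Dtau hk.
  rewrite -(@ler_pXn2r _ 2)// ?nnegrE ?mulr_ge0 ?sqrtr_ge0 ?(ltW tau_0)//.
  rewrite exprMn (sqr_sqrtr (D_ge0 k)).
  rewrite (le_trans (ler_wpM2l (sqr_ge0 x) hk))// mulrCA ler_piMr ?sqr_ge0//.
  by apply: DKpart => //; exact: sqr_ge0.
split=> k hk.
  rewrite /dist_set ge_max lee_fin (ltW tau_0)/=.
  apply: ge_ereal_sup => _ [x Xx <-]; rewrite lee_fin.
  have [|i xi_le] := near_y k x _ Xx.
    by rewrite -(ler_nat R) (le_trans _ hk)// lerDl.
  rewrite (le_trans (dist_pt_le _ _ i))// (le_trans xi_le)//.
  by apply: sqrtD => //; [exact: ltW|rewrite /c; lra].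
have {}hk : K%:R + ktau <= k%:R by rewrite (le_trans _ hk)// lerDl.
rewrite /C' /= !mul1r; split.
  rewrite (le_trans (growth_sqrt k))//; apply: sqrtD => //.
  by rewrite sqr_sqrtr// /c; lra.
rewrite -lerBlDl (le_trans (Dtau k hk))// ler_piMr ?sqr_ge0//.
by have := DKpart 1 ler01; rewrite mul1r; apply; rewrite /c; lra.
Qed.
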